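(* Let $P\subset\mathbb{R}^d$ be a nonempty polyhedral set. Then the function $\varphi_P:\mathbb{R}^d\to\mathbb{Z}$ defined by $$ \varphi_P:=\sum_{F\in\mathcal{F}(P)}(-1)^{\dim F}\,\mathbf{1}_{F-N(P,F)} $$ is constant and takes values in $\{-1,0,1\}$. Moreover, let $P = P_0 + U_P$ be an orthogonal decomposition, where $U_P$ is the lineality space of $P$ and $P_0\subset U_P^\perp$ is a line-free polyhedral set. Then $\varphi_P\equiv (-1)^{\dim U_P}$ if $P_0$ is bounded, and $\varphi_P\equiv 0$ if $P_0$ is unbounded.
   Context: A polyhedral set in $\mathbb{R}^d$ is an intersection of finitely many closed half-spaces, i.e. a set of the form $P=\{x\in\mathbb{R}^d: Mx\le b\}$ with $M$ an $m\times d$-matrix and $b\in\mathbb{R}^m$ (the whole space $\mathbb{R}^d$ is allowed). Polyhedral sets are assumed nonempty. $P$ is line-free if it contains no set $\{x+\lambda y:\lambda\in\mathbb{R}\}$ with $y\neq 0$. The lineality space of a nonempty $P=\{x: Mx\le b\}$ is the linear subspace $U_P=\{x\in\mathbb{R}^d: Mx=0\}$. Every polyhedral set has an orthogonal decomposition $P=P_0+U_P$ with $P_0\subset U_P^\perp$ line-free and polyhedral. $\mathcal{F}(P)$ is the finite set of nonempty faces of $P$, including $P$ itself. The dimension of a face is the dimension of its affine hull. The normal cone of $P$ at $x\in P$ is $N(P,x)=\{u\in\mathbb{R}^d:\langle u,z-x\rangle\le 0\text{ for all }z\in P\}$. For a face $F\in\mathcal{F}(P)$, $N(P,x)$ does not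 depend on the choice of $x$ in the relative interior of $F$, and $N(P,F)$ denotes this common cone. For sets $A,B\subset\mathbb{R}^d$, $A+B=\{a+b: a\in A,b\in B\}$ and $A-B=\{a-b: a\in A,b\in B\}$. $\mathbf{1}_A$ is the indicator function of $A$. *)

(* Defs.v *)
From HB Require Import structures.
From mathcomp Require Import all_boot all_order all_algebra.
From mathcomp Require Import all_classical all_reals all_analysis.

Set Implicit Arguments.
Unset Strict Implicit.
Unset Printing Implicit Defensive.

Import Order.TTheory GRing.Theory Num.Theory.
Import numFieldNormedType.Exports.

Local Open Scope classical_set_scope.
Local Open Scope ring_scope.

Section Polyhedra.
Context {R : realType} {d : nat}.
Implicit Types (A B P F : set 'cV[R]_d) (x y z u : 'cV[R]_d).

Definition dotprod x y : R := \sum_(i < d) x i 0 * y i 0.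

Definition minkowski_sum A B : set 'cV[R]_d := [set a + b | a in A & b in B].
Definition minkowski_diff A B : set 'cV[R]_d := [set a - b | a in A & b in B].

Definition polyhedron m (M : 'M[R]_(m, d)) (b : 'cV[R]_m) : set 'cV[R]_d :=
  [set x | forall i, (M *m x) i 0 <= b i 0].

Definition polyhedral P : Prop :=
  P !=set0 /\
  exists (m : nat) (M : 'M[R]_(m, d)) (b : 'cV[R]_m), P = polyhedron M b.

Definition line_free A : Prop :=
  ~ exists x y, y != 0 /\ forall t : R, A (x + t *: y).

Definition lineality m (M : 'M[R]_(m, d)) : {vspace 'cV[R]_d} :=
  lker (linfun (mulmx M : 'cV[R]_d -> 'cV[R]_m)).

Definition orthogonal_complement (U : {vspace 'cV[R]_d}) : set 'cV[R]_d :=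
  [set x | forall u, u \in U -> dotprod x u = 0].

Definition affine_hull A : set 'cV[R]_d :=
  [set x | exists (n : nat) (a : 'I_n -> R) (p : 'I_n -> 'cV[R]_d),
    [/\ forall i, A (p i), \sum_i a i = 1 & x = \sum_i a i *: p i]].

(* For nonempty A the affine hull is a translate of exactly one linear
   subspace; the value 0 at the empty set is a dummy. *)
Definition affine_dim A : nat :=
  xget 0%N [set k | exists (p : 'cV[R]_d) (U : {vspace 'cV[R]_d}),
    affine_hull A = [set p + u | u in [set` U]] /\ k = \dim U].

Definition relint A : set 'cV[R]_d :=
  [set x | A x /\ \forall y \near x, affine_hull A y -> A y].

(* The inequality <u, x> <= c may be trivial (u = 0), so that P is a face of
   itself. *)
Definition faces P : set (set 'cV[R]_d) :=
  [set F | F !=set0 /\ exists (u : 'cV[R]_d) (c : R),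
    (forall x, P x -> dotprod u x <= c) /\
    F = [set x | P x /\ dotprod u x = c]].

Definition normal_cone P x : set 'cV[R]_d :=
  [set u | forall z, P z -> dotprod u (z - x) <= 0].

(* The cones on the right-hand side all coincide when F is a face of a
   polyhedral set P. *)
Definition face_normal_cone P F : set 'cV[R]_d :=
  \bigcup_(x in relint F) normal_cone P x.

(* The sum is the finitely supported one of fsbigop; finite_faces below ensures
   that it is the genuine sum over all faces. *)
Definition varphi P x : int :=
  \sum_(F \in faces P)
    (-1) ^+ affine_dim F * (\1_(minkowski_diff F (face_normal_cone P F)) x : int).

Lemma dotprodDr u x y : dotprod u (x + y) = dotprod u x + dotprod u y.
Proof.
by rewrite /dotprod -big_split; apply: eq_bigr => i _; rewrite mxE mulrDr.
Qed.

Lemma dotprodZr u (t : R) x : dotprod u (t *: x) = t * dotprod u x.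
Proof.
by rewrite /dotprod mulr_sumr; apply: eq_bigr => i _; rewrite mxE mulrCA.
Qed.

End Polyhedra.

Section FiniteFaces.
Context {R : realType} {d m : nat} (M : 'M[R]_(m, d)) (b : 'cV[R]_m).

Let active (x : 'cV[R]_d) : {set 'I_m} := [set i | (M *m x) i 0 == b i 0].

Let mulME (s t : R) (x y : 'cV[R]_d) i :
  (M *m (s *: x + t *: y)) i 0 = s * (M *m x) i 0 + t * (M *m y) i 0.
Proof. by rewrite mulmxDr -!scalemxAr !mxE. Qed.

Let extend (x y : 'cV[R]_d) : polyhedron M b x -> active x \subset active y ->
  exists2 e : R, 0 < e & polyhedron M b ((1 + e) *: x + (- e) *: y).
Proof.
move=> Px /fintype.subsetP sxy.
pose g i : R := if i \in active x then 1 else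
  (b i 0 - (M *m x) i 0) / (1 + `|(M *m x) i 0 - (M *m y) i 0|).
have den i : 0 < 1 + `|(M *m x) i 0 - (M *m y) i 0|.
  by rewrite ltr_pwDl.
have g0 i : 0 < g i.
  rewrite /g inE; case: eqP => // /eqP xi; rewrite divr_gt0// subr_gt0.
  by rewrite lt_neqAle xi Px.
pose e := \big[Order.min/1]_i g i.
have e0 : 0 < e by rewrite /e; elim/big_ind : _ => // s t s0 t0; rewrite lt_min s0.
exists e => // i; rewrite mulME.
have [ix|ix] := boolP (i \in active x).
  have iy := sxy _ ix; move: ix iy; rewrite !inE => /eqP -> /eqP ->.
  by rewrite -mulrDl addrK mul1r.
have : e <= g i by exact: bigmin_le_cond.
rewrite /g (negbTE ix) ler_pdivlMr// => H.
have : e * ((M *m x) i 0 - (M *m y) i 0) <= b i 0 - (M *m x) i 0.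
  apply: le_trans H; rewrite ler_pM2l//.
  by rewrite (le_trans (ler_norm _))// lerDr.
rewrite lerBrDr => H'; apply: le_trans H'.
by rewrite mulrBr mulrDl mul1r mulNr [leRHS]addrC addrA.
Qed.

Lemma finite_faces : finite_set (faces (polyhedron M b)).
Proof.
pose face_of (I : {set 'I_m}) : set 'cV[R]_d :=
  [set x | polyhedron M b x /\ I \subset active x].
apply: (@sub_finite_set _ _ [set face_of I | I in setT]); last first.
  by apply: finite_image; exact: finite_finset.
move=> F [[x0 Fx0] [u [c [Pc FE]]]].
have [x Fx xmin] : exists2 x, F x & forall y, F y -> (#|active x| <= #|active y|)%N.
  have [n [x Fx nE] nmin] : exists2 n, (exists2 x, F x & #|active x| = n) &
      forall k, (exists2 x, F x & #|active x| = k) -> (n <= k)%N.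
    have ex : exists n, `[< exists2 x, F x & #|active x| = n >].
      by exists #|active x0|; apply/asboolP; exists x0.
    case: (ex_minnP ex) => n /asboolP nP nmin; exists n => // k kP.
    by apply: nmin; apply/asboolP.
  by exists x => // y Fy; rewrite nE; apply: nmin; exists y.
exists (active x) => //; apply/seteqP; split=> y.
  move=> [Py sxy]; rewrite FE; split=> //.
  have : F x by []; rewrite FE => -[Px ux].
  have [e e0 Pz] := extend Px sxy.
  have := Pc _ Pz; rewrite dotprodDr !dotprodZr ux mulrDl mul1r mulNr => H.
  apply/le_anti; rewrite Pc//= -(ler_pM2l e0) -subr_le0.
  by move: H; rewrite -addrA gerDl.
move=> Fy; have : F y by []; rewrite FE => -[Py uy]; split=> //.
have : F x by []; rewrite FE => -[Px ux].
have h0 : (0 : R) < 2^-1 by rewrite invr_gt0.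
have hh (s : R) : 2^-1 * s + 2^-1 * s = s by rewrite -mulrDl -[2^-1]mul1r -splitr mul1r.
pose z := 2^-1 *: x + 2^-1 *: y.
have Pz : polyhedron M b z.
  by move=> i; rewrite mulME -[leRHS]hh lerD// ler_pM2l.
have Fz : F z.
  by rewrite FE; split=> //; rewrite /z dotprodDr !dotprodZr ux uy hh.
have szxy : active z \subset active x :&: active y.
  apply/fintype.subsetP => i; rewrite !inE mulME => /eqP zi.
  have xi := Px i; have yi := Py i; apply/andP; split.
    rewrite eq_le xi/= -(ler_pM2l h0) -(lerD2r (2^-1 * (M *m y) i 0)) zi.
    by rewrite -{2}(hh (b i 0)) lerD2l ler_pM2l.
  rewrite eq_le yi/= -(ler_pM2l h0) -(lerD2l (2^-1 * (M *m x) i 0)) zi.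
  by rewrite -{2}(hh (b i 0)) lerD2r ler_pM2l.
have zx : active z = active x.
  apply/eqP; rewrite eqEcard xmin// andbT.
  exact: fintype.subset_trans szxy (finset.subsetIl _ _).
by rewrite -zx; exact: fintype.subset_trans szxy (finset.subsetIr _ _).
Qed.

End FiniteFaces.

(* Main.v *)
(* Fix x and index the faces of P = {y : M y <= b} by their active sets I; let
   p_I be the orthogonal projection of x onto the affine hull of the face F_I.
   The summand of phi_P at F_I splits into "p_I lies in F_I" and "p_I - x is
   normal to P along F_I".  Consider, for faces F_I included in F_J,
     A(I, J) = (-1)^(dim F_I + dim F_J) [p_J in the tangent cone of F_J at F_I],
     B(I, J) = [p_I - p_J in the normal cone of F_J at F_I].
   An Euler relation for polyhedral cones with two half-space conditions
   (cell_relation) gives B A = 1 with no genericity assumption on x, because the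
   orthogonal projections disappear from this product: it only involves the
   vector p_K - p_I.  Hence A B = 1.  The same Euler relation, applied to the
   homogenization of P, gives the Brianchon-Gram relation
     (-1)^(dim F_J) [p_J in P] = sum_I c_I A(I, J),
   where c_I is (-1)^(dim U_P) if the recession cone of F_I is U_P and 0
   otherwise.  Therefore phi_P(x) = c A B (P) = c_P.
   The Euler relation is proved by slicing along a line direction v: the
   compactly supported Euler characteristic of a function that is
   right-continuous along v and vanishes near -oo along v is zero. *)
From HB Require Import structures.
Require Import Defs.
From mathcomp Require Import all_boot all_order all_algebra.
From mathcomp Require Import all_classical all_reals all_analysis.
From mathcomp Require Import ring lra.

Set Implicit Arguments.
Unset Strict Implicit.
Unset Printing Implicit Defensive.

Import Order.TTheory GRing.Theory Num.Theory.
Import numFieldNormedType.Exports.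

Local Open Scope classical_set_scope.
Local Open Scope ring_scope.

(** * Euler characteristic on the line *)

Lemma sum_fibers0 {I : finType} {E : choiceType} {V : nmodType} (e : I -> E) (F : I -> V) :
  (forall v, \sum_(i | e i == v) F i = 0) -> \sum_i F i = 0.
Proof.
move=> F0; pose p i : seq_sub (codom e) := SeqSub (codom_f e i).
rewrite (partition_big p xpredT)//= big1// => j _.
by rewrite -[RHS](F0 (val j)); apply: eq_bigl => i; rewrite -val_eqE.
Qed.

Section LineEuler.
Context {R : realType}.
Implicit Types (J : set R) (r s t : R).

Definition ind (Q : Prop) : int := `[< Q >]%:R.

Lemma indT (Q : Prop) : Q -> ind Q = 1.
Proof. by move=> q; rewrite /ind asboolT. Qed.

Lemma indF (Q : Prop) : ~ Q -> ind Q = 0.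
Proof. by move=> q; rewrite /ind asboolF. Qed.

Lemma eq_ind (Q Q' : Prop) : (Q <-> Q') -> ind Q = ind Q'.
Proof. by move=> QQ'; congr ind; apply/propext. Qed.

Lemma near0_gt0 : \forall s \near (0 : R)^'+, 0 < s.
Proof. exact: nbhs_right_gt. Qed.

Lemma near0_lt (e : R) : 0 < e -> \forall s \near (0 : R)^'+, s < e.
Proof. exact: nbhs_right_lt. Qed.

(** [None] stands for -oo. The empty set gets a dummy value, so nonemptiness is tested
    separately. *)
Definition left_end J : option R :=
  if pselect (has_lbound J) then Some (inf J) else None.

Definition open_interval J :=
  (forall s t u, J s -> J u -> s <= t <= u -> J t) /\
  (forall t, J t -> \forall s \near (0 : R)^'+, J (t + s) /\ J (t - s)).

(** For small [s] the difference detects a jump just after [r]. An open interval misses its left end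
    but contains the points right after it, hence -1; at its right end both values are 0. *)
Lemma left_end_interval_germ J r : open_interval J ->
  \forall s \near (0 : R)^'+,
    ind (J r) - ind (J (r + s)) = - ind (J !=set0 /\ left_end J = Some r).
Proof.
move=> [Jc Jo].
have [Jr|nJr] := pselect (J r).
  near=> s.
  have Jrs : J (r + s) by near: s; apply: filterS (Jo r Jr) => s [].
  rewrite (indT Jr) (indT Jrs) indF ?oppr0 ?subrr// /left_end.
  case: pselect => lb [_ //] [rE].
  have [s0 [_ Js0] s00] : exists2 s0, (J (r + s0) /\ J (r - s0)) & 0 < s0.
    near (0 : R)^'+ => s0; exists s0; near: s0.
      exact: (Jo r Jr).
    exact: near0_gt0.
  by have := ge_inf lb Js0; rewrite rE; lra.
have [[u [Ju ru]]|nu] := pselect (exists u, J u /\ r < u); last first.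
  near=> s; have s0 : 0 < s by near: s; exact: near0_gt0.
  rewrite !indF ?oppr0 ?subrr//.
    move=> [[u Ju]]; rewrite /left_end; case: pselect => // lb [rE].
    have := ge_inf lb Ju; rewrite rE le_eqVlt => /predU1P[ur|]; first by rewrite ur in nJr.
    by move=> ru; apply: nu; exists u.
  by move=> Jrs; apply: nu; exists (r + s); split=> //; rewrite ltrDl.
have Jr t : J t -> r < t.
  move=> Jt; rewrite ltNge; apply/negP => tr; apply: nJr.
  by apply: (Jc t r u) => //; rewrite tr ltW.
have lb : has_lbound J by exists r => t /Jr/ltW.
have hi : has_inf J by split=> //; exists u.
have ri : r <= inf J by apply: lb_le_inf; [exists u|move=> t /Jr/ltW].
have J0 : J !=set0 by exists u.
have -> : left_end J = Some (inf J) by rewrite /left_end; case: pselect.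
move: ri; rewrite le_eqVlt => /predU1P[rE|ri].
  have ur : 0 < u - r by rewrite subr_gt0.
  near=> s.
  have s0 : 0 < s by near: s; exact: near0_gt0.
  have su : s < u - r by near: s; exact: near0_lt ur.
  rewrite (indF nJr) [in RHS]indT ?rE// indT ?sub0r//.
  have [s' Js'] := inf_adherent s0 hi; rewrite -rE => s'r.
  by apply: (Jc s' _ u) => //; rewrite (ltW s'r)/=; lra.
have ir : 0 < inf J - r by rewrite subr_gt0.
near=> s.
have s0 : s < inf J - r by near: s; exact: near0_lt ir.
rewrite !indF ?oppr0 ?subrr//.
  by move=> [_ [/esym rE]]; rewrite rE ltxx in ri.
by move=> /(ge_inf lb); lra.
Unshelve. all: by end_near. Qed.

(** A point is its own left end and is lost immediately to its right: the jump is +1. *)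
Lemma left_end_point_germ J r : (forall s t, J s -> J t -> s = t) ->
  \forall s \near (0 : R)^'+,
    ind (J r) - ind (J (r + s)) = ind (J !=set0 /\ left_end J = Some r).
Proof.
move=> J1.
have [[u Ju]|J0] := pselect (J !=set0); last first.
  near=> s; rewrite !indF//; first by case.
    by move=> Jr; apply: J0; exists (r + s).
  by move=> Jr; apply: J0; exists r.
have JE : J = [set u].
  by apply/seteqP; split=> [t Jt|_ ->//]; exact: J1.
have -> : left_end J = Some u.
  by rewrite /left_end JE inf1; case: pselect => // -[]; exists u => _ ->.
near=> s.
have s0 : 0 < s by near: s; exact: near0_gt0.
have sur : r < u -> s < u - r.
  near: s; have [ru|ru] := ltP r u; last exact: nearW.
  by apply: filterS (near0_lt (_ : 0 < u - r)) => //; rewrite subr_gt0.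
rewrite JE /=; have [->|/eqP ru] := eqVneq r u.
  by rewrite indT// indF ?indT ?subr0//; [split=> //; exists u|lra].
rewrite !indF//; first by move=> [_ [/esym]].
by move=> ruE; have := sur; rewrite -ruE; lra.
Unshelve. all: by end_near. Qed.

(** The sum is the Euler characteristic with compact support of f = sum_i c_i 1_(J_i): +1 for a
    point, -1 for an open interval. Grouped by left ends, the terms at [r] add up to f(r) - f(r + s)
    for small s, and those at -oo to - f(- t) for large t; both vanish. *)
Lemma line_euler {I : finType} (J : I -> set R) (o : pred I) (c : I -> int) :
  (forall i, o i -> open_interval (J i)) ->
  (forall i, ~~ o i -> forall s t, J i s -> J i t -> s = t) ->
  (forall t, \forall s \near (0 : R)^'+,
    \sum_i c i * ind (J i (t + s)) = \sum_i c i * ind (J i t)) ->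
  (\forall t \near +oo, \sum_i c i * ind (J i (- t)) = 0) ->
  \sum_i c i * (-1) ^+ o i * ind (J i !=set0) = 0.
Proof.
move=> Jo Jp gr goo; apply: (@sum_fibers0 _ (option R) _ (fun i => left_end (J i))) => -[r|].
  pose E i := ind (J i !=set0 /\ left_end (J i) = Some r).
  have germ i : \forall s \near (0 : R)^'+, ind (J i r) - ind (J i (r + s)) = (-1) ^+ o i * E i.
    have [oi|oi] := boolP (o i).
      by rewrite expr1 mulN1r; exact: left_end_interval_germ (Jo _ oi).
    by rewrite expr0 mul1r; exact: left_end_point_germ (Jp _ oi).
  near (0 : R)^'+ => s.
  have gs : \sum_i c i * ind (J i (r + s)) = \sum_i c i * ind (J i r).
    by near: s; exact: (gr r).
  have Es i : ind (J i r) - ind (J i (r + s)) = (-1) ^+ o i * E i.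
    by move: i; near: s; exact: filter_forall germ.
  rewrite big_mkcond/= -[RHS](subrr (\sum_i c i * ind (J i r))) -{2}gs -sumrB.
  apply: eq_bigr => i _; rewrite -mulrBr Es mulrA; case: eqP => [lE|nE].
    by congr (_ * _); apply: eq_ind; rewrite lE; split=> [|[]].
  by rewrite /E indF ?mulr0// => -[].
have germ i : \forall t \near +oo,
    ind (J i (- t)) = ind (J i !=set0 /\ left_end (J i) = None).
  have [[u Ju]|J0] := pselect (J i !=set0); last first.
    by near=> t; rewrite !indF//; [case|move=> Jt; apply: J0; exists (- t)].
  rewrite /left_end; case: pselect => lb.
    near=> t; rewrite !indF//; first by case.
    move=> /(ge_inf lb); apply/negP; rewrite -ltNge ltrNl.
    by near: t; exact: nbhs_pinfty_gt (num_real _).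
  have oi : o i.
    have [//|oi] := boolP (o i); case: lb; exists u => v Jv.
    by rewrite (Jp _ oi _ _ Ju Jv).
  have [Jc _] := Jo _ oi.
  near=> t.
  have tu : - u < t by near: t; exact: nbhs_pinfty_gt (num_real _).
  rewrite [RHS]indT; last by split=> //; exists u.
  rewrite indT//.
  have [v Jv vt] : exists2 v, J i v & v < - t.
    apply: contrapT => nv; apply: lb; exists (- t) => v Jv.
    by rewrite leNgt; apply/negP => vt; apply: nv; exists v.
  by apply: (Jc v _ u) => //; rewrite (ltW vt)/= lerNl ltW.
near (+oo : set_system R) => t.
have gt : \sum_i c i * ind (J i (- t)) = 0 by near: t; exact: goo.
have Et i : ind (J i (- t)) = ind (J i !=set0 /\ left_end (J i) = None).
  by move: i; near: t; exact: filter_forall germ.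
transitivity (- \sum_i c i * ind (J i (- t))); last by rewrite gt oppr0.
rewrite -sumrN big_mkcond/=; apply: eq_bigr => i _.
rewrite Et; case: eqP => [lE|nE]; last by rewrite indF ?mulr0 ?oppr0// => -[].
have [oi|oi] := boolP (o i).
  by rewrite expr1 mulrN1 mulNr; congr (- (_ * _)); apply: eq_ind; split=> [|[]].
suff J0 : ~ (J i !=set0) by rewrite !indF ?mulr0 ?oppr0// => -[].
move=> [u Ju]; move: lE; rewrite /left_end; case: pselect => // -[]; exists u => v Jv.
by rewrite (Jp _ oi _ _ Ju Jv).
Unshelve. all: by end_near. Qed.

End LineEuler.

(** * Euler relations for relatively open convex sets *)

Section Euler.
Context {R : realType} {V : vectType R}.
Implicit Types (W S : {vspace V}) (A : set V) (x h : V).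

(* Algebraic openness in W suffices, and makes images under linear maps
   relatively open for free. *)
Definition relopen W A := [/\ A `<=` [set` W],
  forall u v (t : R), A u -> A v -> 0 <= t <= 1 -> A (u + t *: (v - u)) &
  forall u w, A u -> w \in W -> \forall s \near (0 : R)^'+, A (u + s *: w)].

Lemma relopen_limg (f : 'End(V)) W A : relopen W A -> relopen (f @: W) (f @` A).
Proof.
move=> [AW Ac Ao]; split.
- by move=> _ [u /AW uW <-]; exact: memv_img.
- move=> _ _ t [u Au <-] [v Av <-] t01; exists (u + t *: (v - u)); first exact: Ac.
  by rewrite linearD linearZ linearB.
- move=> _ w [u Au <-] /memv_imgP[v vW ->].
  by apply: filterS (Ao _ _ Au vW) => s As; exists (u + s *: v) => //; rewrite linearD linearZ.
Qed.

Lemma relopen_line_interval W A x h : relopen W A -> x \in W ->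
  open_interval [set t : R | A (h + t *: x)].
Proof.
move=> [_ Ac Ao] xW; split=> [s t u /= As Au /andP[st tu]|t /= At].
  move: st; rewrite le_eqVlt => /predU1P[<- //|st].
  have su : 0 < u - s by rewrite subr_gt0 (lt_le_trans st).
  have := Ac _ _ ((t - s) / (u - s)) As Au.
  rewrite opprD addrACA subrr add0r -scalerBl scalerA divfK ?gt_eqF//.
  rewrite -addrA -scalerDl [s + _]addrC subrK; apply.
  by rewrite ler_pdivlMr// mul0r subr_ge0 (ltW st) ler_pdivrMr// mul1r lerD2r.
have xW' : - x \in W by rewrite memvN.
apply: filterS2 (Ao _ _ At xW) (Ao _ _ At xW') => s.
by rewrite scalerN -addrA -scalerDl -addrA -scalerBl.
Qed.

Lemma relopen_line_point W A x h : relopen W A -> x \notin W ->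
  forall s t : R, A (h + s *: x) -> A (h + t *: x) -> s = t.
Proof.
move=> [AW _ _] xW s t /AW/= As /AW/= At; apply/eqP; apply: contraNT xW => st.
have := memvB As At; rewrite opprD addrACA subrr add0r -scalerBl.
by rewrite rpredZeq subr_eq0 (negbTE st).
Qed.

(** A model inside [V] of the quotient by the line [<[x]>], so that induction on the dimension stays
    within one space. *)
Definition proj_along x : 'End(V) := (\1 - projv <[x]>)%VF.

Lemma lker_proj_along x : lker (proj_along x) = <[x]>%VS.
Proof.
apply/vspaceP => v; rewrite memv_ker add_lfunE opp_lfunE id_lfunE subr_eq0.
by apply/eqP/idP => [->|/projv_id ->//]; exact: memv_proj.
Qed.

Lemma line_section_neq0 A x h :
  [set t : R | A (h + t *: x)] !=set0 <-> (proj_along x @` A) (proj_along x h).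
Proof.
split=> [[t /= At]|[u Au uh]].
  exists (h + t *: x) => //; rewrite linearD; apply/eqP; rewrite -subr_eq0 addrC addKr.
  by rewrite -memv_ker lker_proj_along memvZ ?memv_line.
have : u - h \in lker (proj_along x) by rewrite memv_ker linearB /= uh subrr.
rewrite lker_proj_along => /vlineP[t ut]; exists t => /=.
by rewrite -ut addrC subrK.
Qed.

(** The dimension lost by projecting is the exponent of the sign that [line_euler] attaches to a
    section: an open interval if [x \in W], at most a point otherwise. *)
Lemma dim_proj_along x W : x != 0 ->
  ((x \in W) + \dim (proj_along x @: W) = \dim W)%N.
Proof.
move=> x0; rewrite -(limg_ker_dim (proj_along x) W) lker_proj_along; congr addn.
have [xW|xW] := boolP (x \in W).
  by rewrite (capv_idPr _) ?dim_vline ?x0// -memvE.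
rewrite (_ : (W :&: <[x]>)%VS = 0%VS) ?dimv0//; apply/eqP; rewrite -subv0.
apply/subvP => v; rewrite memv_cap memv0 => /andP[vW /vlineP[t vE]].
apply: contraNT xW => v0; move: v0 vW.
by rewrite vE rpredZeq scaler_eq0 negb_or => /andP[/negbTE ->].
Qed.

Section Family.
Context {I : finType} (W : I -> {vspace V}) (A : I -> set V) (c : I -> int).
Hypothesis AW : forall i, relopen (W i) (A i).

(** The fibre over a point of the image is a line [h + t *: x], which meets the sets in open
    intervals or at most points; [line_euler] applies to it. *)
Lemma proj_euler x : x != 0 ->
  (forall h, \forall s \near (0 : R)^'+,
    \sum_i c i * ind (A i (h + s *: x)) = \sum_i c i * ind (A i h)) ->
  (forall h, \forall t \near (+oo : set_system R), \sum_i c i * ind (A i (h - t *: x)) = 0) ->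
  forall p, \sum_i c i * (-1) ^+ (x \in W i) * ind ((proj_along x @` A i) p) = 0.
Proof.
move=> x0 gr goo p.
have [[h <-{p}]|np] := pselect (exists h, proj_along x h = p); last first.
  by rewrite big1// => i _; rewrite indF ?mulr0// => -[u _ up]; apply: np; exists u.
under eq_bigr do rewrite -(eq_ind (line_section_neq0 _ _ _)).
apply: (@line_euler _ _ _ (fun i => x \in W i)).
- by move=> i; exact: relopen_line_interval.
- by move=> i; exact: relopen_line_point.
- move=> t; apply: filterS (gr (h + t *: x)) => s /= <-.
  by apply: eq_bigr => i _; rewrite scalerDl addrA.
- by apply: filterS (goo h) => t /= E; rewrite -[RHS]E; apply: eq_bigr => i _; rewrite /= scaleNr.
Qed.

End Family.

(** Induction on the dimension of a subspace [S] containing all [W i]: a zero combination trivially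
    satisfies the hypotheses of [proj_euler] along a nonzero [x] in [S], and its projection is again
    a zero combination. *)
Lemma euler_relation0 {I : finType} (W : I -> {vspace V}) (A : I -> set V) (c : I -> int) :
  (forall i, relopen (W i) (A i)) ->
  (forall h, \sum_i c i * ind (A i h) = 0) ->
  \sum_i c i * (-1) ^+ \dim (W i) * ind (A i !=set0) = 0.
Proof.
have [n] := ubnP (\dim (fullv : {vspace V})).
have : forall i, (W i <= fullv)%VS by move=> i; exact: subvf.
elim: n (fullv) W A c => // n IH S W A c WS Sn AW A0.
have [S0|/eqP S0] := eqVneq S 0%VS.
  have W0 i : W i = 0%VS by apply/eqP; rewrite -subv0 -S0.
  rewrite -[RHS](A0 0); apply: eq_bigr => i _; rewrite W0 dimv0 expr0 mulr1; congr (_ * _).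
  apply: eq_ind; split=> [[u Au]|]; last by exists 0.
  have [AWi _ _] := AW i; have := AWi _ Au; rewrite /= W0 memv0 => /eqP u0.
  by rewrite -u0.
pose x := vpick S.
have x0 : x != 0 by rewrite vpick0; apply/eqP.
have xS : x \in S by exact: memv_pick.
have P0 := proj_euler AW x0.
have := IH (proj_along x @: S)%VS (fun i => proj_along x @: W i)%VS
  (fun i => proj_along x @` A i) (fun i => c i * (-1) ^+ (x \in W i)).
have -> : \sum_i c i * (-1) ^+ (x \in W i) * (-1) ^+ \dim (proj_along x @: W i) *
    ind (proj_along x @` A i !=set0) = \sum_i c i * (-1) ^+ \dim (W i) * ind (A i !=set0).
  apply: eq_bigr => i _; rewrite -mulrA -(dim_proj_along (W i) x0) exprD mulrA -!mulrA.
  do 3 congr (_ * _); apply: eq_ind; split=> [[_ [u Au _]]|[u Au]]; first by exists u.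
  by exists (proj_along x u), u.
apply.
- by move=> i; apply: limgS.
- by rewrite -ltnS (leq_trans _ Sn)// ltnS -(dim_proj_along S x0) xS.
- by move=> i; exact: relopen_limg.
- apply: P0 => h; last by apply: nearW => t.
  by apply: nearW => s; rewrite !A0.
Qed.

(** One slicing along [x] yields a combination that vanishes identically, to which [euler_relation0]
    applies. *)
Lemma euler_relation {I : finType} (W : I -> {vspace V}) (A : I -> set V) (c : I -> int) x :
  (forall i, relopen (W i) (A i)) -> x != 0 ->
  (forall h, \forall s \near (0 : R)^'+,
    \sum_i c i * ind (A i (h + s *: x)) = \sum_i c i * ind (A i h)) ->
  (forall h, \forall t \near (+oo : set_system R), \sum_i c i * ind (A i (h - t *: x)) = 0) ->
  \sum_i c i * (-1) ^+ \dim (W i) * ind (A i !=set0) = 0.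
Proof.
move=> AW x0 gr goo; have P0 := proj_euler AW x0 gr goo.
have E := euler_relation0 (fun i => relopen_limg (proj_along x) (AW i)) P0.
rewrite -[RHS]E; apply: eq_bigr => i _; rewrite -(dim_proj_along (W i) x0) exprD !mulrA.
congr (_ * _); apply: eq_ind; split=> [[u Au]|[_ [u Au _]]]; last by exists u.
by exists (proj_along x u), u.
Qed.

End Euler.

(** * Cells of a polyhedral cone *)

Section Cells.
Context {R : realType} {V : vectType R} {T : finType} (a : T -> {linear V -> R^o}).
Implicit Types (I J K : {set T}) (h x : V).

Lemma formD (w : {linear V -> R^o}) h (s : R) x : w (h + s *: x) = w h + s * w x.
Proof. by rewrite linearD linearZ. Qed.

Definition zeros J : {vspace V} := (\bigcap_(j in J) lker (linfun (a j)))%VS.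

Lemma zerosP J h : reflect (forall j, j \in J -> a j h = 0) (h \in zeros J).
Proof.
apply: (iffP idP) => [|hJ]; rewrite memvE.
  move=> /subv_bigcapP hJ j /hJ; rewrite -memvE memv_ker lfunE => /eqP.
  exact.
by apply/subv_bigcapP => j jJ; rewrite -memvE memv_ker lfunE /= hJ.
Qed.

(** For [J] included in [I], these sets partition the cone where all [a i] with [i] in [I] are
    nonpositive; the nonempty ones are the relative interiors of its faces. *)
Definition cell I J : set V :=
  [set h | (forall j, j \in J -> a j h = 0) /\
           (forall i, i \in I -> i \notin J -> a i h < 0)].

Lemma near0_lt_form (r s : R) : r < 0 -> \forall t \near (0 : R)^'+, r + t * s < 0.
Proof.
move=> r0; have e0 : 0 < - r / (1 + `|s|).
  by rewrite divr_gt0 ?oppr_gt0// ltr_pwDl.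
near=> t.
have t0 : 0 < t by near: t; exact: near0_gt0.
have te : t * (1 + `|s|) < - r.
  by rewrite -ltr_pdivlMr ?ltr_pwDl//; near: t; exact: near0_lt e0.
have : t * s <= t * `|s| by rewrite ler_pM2l// ler_norm.
by nra.
Unshelve. all: by end_near. Qed.

Lemma segment_lt0 (r s t : R) : r < 0 -> s < 0 -> 0 <= t <= 1 -> r + t * (s - r) < 0.
Proof.
move=> r0 s0 /andP[]; rewrite le_eqVlt => /predU1P[<-|t0] t1; first by rewrite mul0r addr0.
have : t * s < 0 by rewrite pmulr_rlt0.
by have : (1 - t) * r <= 0 by [rewrite mulr_ge0_le0 ?subr_ge0// ltW]; lra.
Qed.

Lemma relopen_cell I J : relopen (zeros J) (cell I J).
Proof.
split=> [h [h0 _]|u v t [u0 uI] [v0 vI] t01|u w [u0 uI] /zerosP wJ].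
- exact/zerosP.
- split=> [j jJ|i iI iJ]; rewrite formD linearB.
    by rewrite u0// v0// subr0 mulr0 addr0.
  by apply: segment_lt0 => //; [exact: uI|exact: vI].
- have : \forall s \near (0 : R)^'+, forall i, (i \in I) && (i \notin J) -> a i (u + s *: w) < 0.
    apply: filter_forall => i; have [/andP[iI iJ]|_] := boolP (_ && _); last exact: nearW.
    by apply: filterS (near0_lt_form (a i w) (uI _ iI iJ)) => s + _; rewrite formD.
  apply: filterS => s sI; split=> [j jJ|i iI iJ]; last by apply: sI; rewrite iI.
  by rewrite formD u0// wJ// mulr0 addr0.
Qed.

Lemma relopen_cell_lt0 (w : {linear V -> R^o}) I J :
  relopen (zeros J) (cell I J `&` [set h | w h < 0]).
Proof.
have [cW cc co] := relopen_cell I J; split.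
- by move=> h [/cW].
- move=> u v t [cu wu] [cv wv] t01; split; first exact: cc.
  by rewrite /= formD linearB; exact: segment_lt0.
- move=> u v [cu wu] vJ; apply: filterS2 (co _ _ cu vJ) (near0_lt_form (w v) wu) => s cs ws.
  by split=> //=; rewrite formD.
Qed.

Let active I h := [set i in I | a i h == 0].

Let cell_active I J h : (J \subset I)%SET -> cell I J h -> J = active I h.
Proof.
move=> /fintype.subsetP JI [hJ hI]; apply/setP => i; rewrite inE.
have [iJ|iJ] := boolP (i \in J); first by rewrite (JI _ iJ) hJ// eqxx.
by apply/esym/negP => /andP[iI]; have := hI _ iI iJ; rewrite lt_def eq_sym => /andP[/negP].
Qed.

(* Cells on which w takes negative values are counted together with their part
   in {w < 0}, which has the same dimension and the opposite coefficient.  The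
   resulting function is the indicator of a set whose sections along x are
   bounded below by w, and closed below, open above. *)
Lemma cell_relation (w : {linear V -> R^o}) x I K :
  (K \subset I)%SET -> (forall k, k \in K -> a k x = 0) -> 0 < w x ->
  \sum_(J : {set T} | (K \subset J)%SET && (J \subset I)%SET)
    (-1) ^+ \dim (zeros J) * ind [/\ cell I J !=set0,
      forall j, j \in J -> a j x <= 0 & forall h, cell I J h -> 0 <= w h] = 0.
Proof.
move=> KI xK wx.
pose good J := [&& (K \subset J)%SET, (J \subset I)%SET & [forall j in J, a j x <= 0]].
pose c (b : bool * {set T}) : int := (-1) ^+ b.1 *+ good b.2.
pose A (b : bool * {set T}) :=
  if b.1 then cell I b.2 `&` [set h | w h < 0] else cell I b.2.
have Ao b : relopen (zeros b.2) (A b).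
  by case: b => -[] J; [exact: relopen_cell_lt0|exact: relopen_cell].
have x0 : x != 0 by apply: contraTneq wx => ->; rewrite linear0 ltxx.
(* A form that vanishes at [h] must not increase along [x]: this makes membership in [Q]
   right-continuous along [x]. *)
pose Q h := [/\ forall k, k \in K -> a k h = 0,
  forall i, i \in I -> a i h < 0 \/ a i h = 0 /\ a i x <= 0 & 0 <= w h].
have sumb (F : bool * {set T} -> int) : \sum_b F b = \sum_J (F (false, J) + F (true, J)).
  rewrite (eq_bigr (fun b => F (b.1, b.2))); last by case.
  rewrite -(pair_bigA _ (fun b J => F (b, J)))/= exchange_big/=.
  by apply: eq_bigr => J _; rewrite big_bool addrC.
have sumQ h : \sum_b c b * ind (A b h) = ind (Q h).
  rewrite sumb (eq_bigr (fun J => ind (good J /\ cell I J h /\ 0 <= w h))); last first.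
    move=> J _; rewrite /c /A /= expr0 expr1.
    have [gJ|gJ] := boolP (good J); last by rewrite !mulr0n !mul0r addr0 indF// => -[].
    have [cJ|cJ] := pselect (cell I J h); last by rewrite !indF ?mulr0 ?addr0//; [case=> _ []|case].
    rewrite mulr1n mul1r (indT cJ) mulr1n mulN1r.
    have [wh|wh] := ltP (w h) 0.
      by rewrite [X in _ - X]indT// subrr indF// => -[_ []].
    rewrite indF; last by case.
    by rewrite subr0 indT.
  have [[hK hI wh]|nQ] := pselect (Q h).
    rewrite (bigD1 (active I h))//= [X in _ + X]big1 ?addr0; last first.
      move=> J Jh; apply: indF => -[/and3P[_ JI _] [/(cell_active JI) JE _]].
      by rewrite JE eqxx in Jh.
    rewrite !indT//; split.
      apply/and3P; split.
      + apply/fintype.subsetP => k kK; rewrite inE hK// eqxx andbT.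
        exact: (fintype.subsetP KI).
      + by apply/fintype.subsetP => i; rewrite inE => /andP[].
      + apply/forall_inP => i; rewrite inE => /andP[iI /eqP hi].
        by case: (hI _ iI) => [|[]//]; rewrite hi ltxx.
    split=> //; split=> [j|i iI]; first by rewrite inE => /andP[_ /eqP].
    by rewrite inE iI/= => hi; case: (hI _ iI) => // -[hi0]; rewrite hi0 eqxx in hi.
  rewrite [RHS]indF// big1// => J _; apply: indF => -[/and3P[KJ JI /forall_inP Jx]] [[hJ hI] wh].
  apply: nQ; split=> // [k kK|i iI]; first exact: hJ (fintype.subsetP KJ _ kK).
  by have [iJ|iJ] := boolP (i \in J); [right; rewrite hJ//; split=> //; exact: Jx|left; exact: hI].
transitivity (\sum_b c b * (-1) ^+ \dim (zeros b.2) * ind (A b !=set0)); last first.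
  apply: (euler_relation Ao x0); last first.
    move=> h; near=> t; rewrite sumQ indF// => -[_ _].
    rewrite -scaleNr formD mulNr subr_ge0 leNgt -ltr_pdivrMr// => /negP; apply.
    by near: t; exact: nbhs_pinfty_gt (num_real _).
  move=> h.
  have QI : \forall s \near (0 : R)^'+, forall i, i \in I ->
      (a i (h + s *: x) < 0 \/ a i (h + s *: x) = 0 /\ a i x <= 0) <->
      (a i h < 0 \/ a i h = 0 /\ a i x <= 0).
    apply: filter_forall => i; have [ai0|ai0|ai0] := ltgtP (a i h) 0.
    + apply: filterS (near0_lt_form (a i x) ai0) => s; rewrite formD => ais _.
      by split=> _; left.
    + have : - a i h < 0 by rewrite oppr_lt0.
      move=> /near0_lt_form-/(_ (- a i x)); apply: filterS => s; rewrite formD => ais _.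
      by split=> [[|[]]|[|[]]]; lra.
    + apply: filterS near0_gt0 => s s0 _; rewrite formD ai0 add0r.
      split=> [[]|[]]; [|by move=> [_ ?]; right|by []|move=> [_]].
        by rewrite pmulr_rlt0// => /ltW; right.
      by case: (ltgtP (a i x) 0) => // ix _; [left; rewrite pmulr_rlt0|right; rewrite ix mulr0].
  have Qw : \forall s \near (0 : R)^'+, 0 <= w (h + s *: x) <-> 0 <= w h.
    have [wh|wh] := ltP (w h) 0.
      apply: filterS (near0_lt_form (w x) wh) => s; rewrite formD => ws.
      by split=> //; lra.
    by apply: filterS near0_gt0 => s s0; rewrite formD; split=> // _; nra.
  apply: filterS2 QI Qw => s QI Qw; rewrite !sumQ; apply: eq_ind.
  have KE k : k \in K -> a k (h + s *: x) = a k h.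
    by move=> kK; rewrite formD xK// mulr0 addr0.
  split=> -[hK hI wh]; split.
  + by move=> k kK; rewrite -KE// hK.
  + by move=> i iI; apply/(QI _ iI)/hI.
  + exact/Qw.
  + by move=> k kK; rewrite KE// hK.
  + by move=> i iI; apply/(QI _ iI)/hI.
  + exact/Qw.
rewrite sumb big_mkcond/=; apply: eq_bigr => J _; rewrite /c /A /= expr0 expr1.
  have [/andP[KJ JI]|KJI] := ifPn; last first.
    by rewrite /good andbA (negbTE KJI) !mulr0n !mul0r addr0.
  rewrite /good KJ JI /=; have [/forall_inP Jx|Jx] := boolP [forall j in J, a j x <= 0]; last first.
    rewrite !mulr0n !mul0r addr0 indF ?mulr0// => -[_ Jx' _].
    by case/negP: Jx; apply/forall_inP.
  rewrite !mulr1n mul1r mulN1r mulNr -mulrBr; congr (_ * _).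
  have [[u cu]|c0] := pselect (cell I J !=set0); last first.
    rewrite (indF c0) [X in _ - X]indF; last by move=> [u [cu _]]; apply: c0; exists u.
    by rewrite subrr indF// => -[].
  rewrite (indT (_ : cell I J !=set0)); last by exists u.
  have [[v [cv wv]]|nv] := pselect (cell I J `&` [set h | w h < 0] !=set0).
    rewrite (indT (_ : _ !=set0)); last by exists v.
    by rewrite subrr indF// => -[_ _ /(_ _ cv)]; rewrite leNgt wv.
  rewrite (indF nv) subr0 indT//; split=> // [|h ch]; first by exists u.
  by rewrite leNgt; apply/negP => wh; apply: nv; exists h.
Unshelve. all: by end_near. Qed.

End Cells.

(** * Scalar product and orthogonal projection *)

Section Dotprod.
Context {R : realType} {d : nat}.
Implicit Types (u v x h : 'cV[R]_d) (W : {vspace 'cV[R]_d}).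

Lemma dotprodC u v : dotprod u v = dotprod v u.
Proof. by apply: eq_bigr => i _; rewrite mulrC. Qed.

Lemma dotprodBl u v h : dotprod (u - v) h = dotprod u h - dotprod v h.
Proof.
by rewrite dotprodC dotprodDr -scaleN1r dotprodZr mulN1r !(dotprodC h).
Qed.

Lemma dotprod0l h : dotprod 0 h = 0.
Proof. by apply: big1 => i _; rewrite mxE mul0r. Qed.

Lemma dotprod_gt0 u : u != 0 -> 0 < dotprod u u.
Proof.
move=> u0; rewrite lt_def sumr_ge0 ?andbT; last by move=> i _; exact: sqr_ge0.
apply: contra_neq u0 => /eqP; rewrite psumr_eq0; last by move=> i _; exact: sqr_ge0.
move=> /allP u0; apply/colP => i; rewrite mxE.
by have := u0 i; rewrite mem_index_enum mulf_eq0 orbb => /(_ isT)/eqP.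
Qed.

Definition dot_form u h : R^o := dotprod u h.

Fact dot_form_is_linear u : linear (dot_form u).
Proof. by move=> t v w; rewrite /dot_form dotprodDr dotprodZr. Qed.

HB.instance Definition _ u :=
  GRing.isLinear.Build R 'cV[R]_d R^o _ (dot_form u) (dot_form_is_linear u).

(** Gram-Schmidt by induction on the dimension: project onto the orthogonal complement [W'] of a
    nonzero [x] inside [W], then correct along [x]. *)
Lemma orthogonal_projection W v :
  exists2 w, w \in W & forall h, h \in W -> dotprod (v - w) h = 0.
Proof.
have [n] := ubnP (\dim W); elim: n W => // n IH W Wn.
have [->|/eqP W0] := eqVneq W 0%VS.
  exists 0; first exact: mem0v.
  by move=> h; rewrite memv0 => /eqP ->; rewrite dotprodC dotprod0l.
pose x := vpick W.
have xW : x \in W by exact: memv_pick.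
have xx : 0 < dotprod x x by apply: dotprod_gt0; rewrite vpick0; apply/eqP.
pose W' := (W :&: lker (linfun (dot_form x)))%VS.
have memW' h : (h \in W') = (h \in W) && (dotprod x h == 0).
  by rewrite memv_cap memv_ker lfunE.
have W'n : (\dim W' < n)%N.
  rewrite -ltnS (leq_trans _ Wn)// ltnS ltn_neqAle dimvS ?capvSl// andbT.
  apply: contraTneq xx => WE; have : W' = W by apply/eqP; rewrite eqEdim capvSl WE leqnn.
  by move=> W'W; have := xW; rewrite -W'W memW' => /andP[_ /eqP ->]; rewrite ltxx.
have [w wW' wP] := IH _ W'n.
have wW : w \in W by move: wW'; rewrite memW' => /andP[].
exists (w + (dotprod (v - w) x / dotprod x x) *: x); first by rewrite memvD// memvZ.
set t := _ / _ => h hW; pose s := dotprod x h / dotprod x x.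
have hW' : dotprod (v - w) (h - s *: x) = 0.
  apply: wP; rewrite memW' memvB ?memvZ//=.
  by rewrite -scaleNr dotprodDr dotprodZr mulNr /s divfK ?subrr ?(gt_eqF xx).
move: hW'; rewrite -scaleNr dotprodDr dotprodZr => hE.
rewrite opprD addrA dotprodBl (dotprodC (t *: x)) dotprodZr (dotprodC h).
have -> : dotprod (v - w) h = s * dotprod (v - w) x by lra.
by rewrite /s /t; field; rewrite gt_eqF.
Qed.

End Dotprod.

Lemma mul_ind (Q Q' : Prop) : ind Q * ind Q' = ind (Q /\ Q').
Proof. by rewrite /ind asbool_and -natrM mulnb. Qed.

(** A one-sided inverse of a square matrix over a commutative ring is two-sided; the index set [D]
    is transported to an ordinal in order to use [mulmx1C]. *)
Lemma inverse_in {T : finType} (D : {pred T}) (f g : T -> T -> int) :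
  (forall i k, i \in D -> k \in D -> \sum_(j in D) f i j * g j k = (i == k)%:R) ->
  forall i k, i \in D -> k \in D -> \sum_(j in D) g i j * f j k = (i == k)%:R.
Proof.
move=> fg i k iD kD.
pose mx (e : T -> T -> int) := \matrix_(r < #|D|, s < #|D|) e (enum_val r) (enum_val s).
have mulE (e e' : T -> T -> int) r s :
    (mx e *m mx e') r s = \sum_(j in D) e (enum_val r) j * e' j (enum_val s).
  by rewrite mxE [RHS]big_enum_val; apply: eq_bigr => l _; rewrite !mxE.
have /mulmx1C/matrixP/(_ (enum_rank_in iD i) (enum_rank_in iD k)) : mx f *m mx g = 1%:M.
  by apply/matrixP => r s; rewrite mulE mxE fg ?enum_valP// (inj_eq enum_val_inj).
rewrite mulE !enum_rankK_in// mxE => ->; congr (_%:R); congr nat_of_bool.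
by apply/eqP/eqP => [/(congr1 enum_val)|<-//]; rewrite !enum_rankK_in.
Qed.

(** * Active sets and cells of tangent cones *)

Section ActiveSets.
Context {R : realType} {d m : nat} (M : 'M[R]_(m, d)) (b : 'cV[R]_m).
Implicit Types (I J K : {set 'I_m}) (x y z h : 'cV[R]_d).

Let P := polyhedron M b.

Definition row_form i h : R^o := (M *m h) i 0.

Fact row_form_is_linear i : linear (row_form i).
Proof. by move=> t u v; rewrite /row_form mulmxDr -scalemxAr !mxE. Qed.

HB.instance Definition _ i :=
  GRing.isLinear.Build R 'cV[R]_d R^o _ (row_form i) (row_form_is_linear i).

Let W := zeros row_form.

Lemma zeros_row_formT : W [set: 'I_m]%SET = lineality M.
Proof.
apply/vspaceP => h; rewrite memv_ker lfunE/=; apply/zerosP/eqP => [h0|h0 i _].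
  by apply/colP => i; rewrite [RHS]mxE; exact: h0 i (finset.in_setT i).
by rewrite /= /row_form h0 mxE.
Qed.

Definition active x := [set i | (M *m x) i 0 == b i 0]%SET.

Definition feasible I := exists2 y, P y & active y = I.

Lemma activeP x i : reflect (row_form i x = b i 0) (i \in active x).
Proof. by rewrite inE; exact: eqP. Qed.

Lemma lt_inactive x i : P x -> i \notin active x -> row_form i x < b i 0.
Proof. by move=> Px; rewrite inE lt_neqAle Px andbT. Qed.

(** Inequalities inactive at [y] survive a short step, so the cell of the tangent cone at [y] that
    contains [h] determines the active set just after [y]. *)
Lemma near_active y h J : P y -> (J \subset active y)%SET -> cell row_form (active y) J h ->
  \forall s \near (0 : R)^'+, P (y + s *: h) /\ active (y + s *: h) = J.
Proof.
move=> Py /fintype.subsetP JI [hJ hI].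
have : \forall s \near (0 : R)^'+, forall i,
    if i \in J then row_form i (y + s *: h) = b i 0 else row_form i (y + s *: h) < b i 0.
  apply: filter_forall => i; have [iJ|iJ] := boolP (i \in J).
    by apply: nearW => s; rewrite formD hJ// mulr0 addr0; exact/activeP/JI.
  have [iy|iy] := boolP (i \in active y).
    apply: filterS near0_gt0 => s s0; rewrite formD /= (activeP _ _ iy) gtrDl.
    by rewrite pmulr_rlt0// hI.
  have : row_form i y - b i 0 < 0 by rewrite subr_lt0 lt_inactive.
  move=> /near0_lt_form-/(_ (row_form i h)); apply: filterS => s; rewrite formD; lra.
apply: filterS => s sP; split.
  move=> i; change (row_form i (y + s *: h) <= b i 0).
  by have := sP i; case: ifP => _ => [->|/ltW].
apply/setP => i; have := sP i; case: ifPn => iJ; first by move/activeP => ->.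
by move=> lti; apply/negbTE/negP => /activeP E; rewrite E ltxx in lti.
Qed.

(** A difference of points gives a cell vector, and a short step along a cell vector gives a
    point. *)
Lemma feasible_cell I J : feasible I -> (J \subset I)%SET ->
  feasible J <-> cell row_form I J !=set0.
Proof.
move=> [y Py yI] JI; subst I; split=> [[z Pz zJ]|[h ch]].
  subst J; exists (z - y); split=> [j jz|i iy iz]; rewrite linearB /=.
    by rewrite (activeP _ _ jz) (activeP _ _ (fintype.subsetP JI _ jz)) subrr.
  by rewrite /= (activeP _ _ iy) subr_lt0 lt_inactive.
near (0 : R)^'+ => s; exists (y + s *: h).
  by near: s; apply: filterS (near_active Py JI ch) => s [].
by near: s; apply: filterS (near_active Py JI ch) => s [].
Unshelve. all: by end_near. Qed.

(** [p I] is the orthogonal projection of [x] onto the affine hull of the face of [I]. Infeasible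
    [I] receive the dummy 0. *)
Lemma feet_exist x : exists p : {set 'I_m} -> 'cV[R]_d, forall I, feasible I ->
  (forall i, i \in I -> row_form i (p I) = b i 0) /\
  (forall h, h \in W I -> dotprod (x - p I) h = 0).
Proof.
suff /choice[p pP] : forall I, exists p, feasible I ->
  (forall i, i \in I -> row_form i p = b i 0) /\ (forall h, h \in W I -> dotprod (x - p) h = 0).
  by exists p.
move=> I; have [[y Py yI]|nI] := pselect (feasible I); last by exists 0.
have [w /zerosP wW wP] := orthogonal_projection (W I) (x - y).
exists (y + w) => _; split=> [i iI|h hW]; last by rewrite opprD addrA wP.
by rewrite linearD wW// addr0; apply/activeP; rewrite yI.
Qed.

End ActiveSets.

(** * The two mutually inverse incidence matrices *)

Section Incidence.
Context {R : realType} {d m : nat} (M : 'M[R]_(m, d)) (b : 'cV[R]_m).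
Implicit Types (I J K : {set 'I_m}) (y z h : 'cV[R]_d).

Let P := polyhedron M b.
Let W := zeros (row_form M).
Let feas := feasible M b.

Lemma polyhedronP y : P y <-> forall i, row_form M i y <= b i 0.
Proof. by []. Qed.

Section Feet.
Context (x : 'cV[R]_d) (p : {set 'I_m} -> 'cV[R]_d).
Hypothesis pP : forall I, feas I ->
  (forall i, i \in I -> row_form M i (p I) = b i 0) /\
  (forall h, h \in W I -> dotprod (x - p I) h = 0).

(** The matrix A. As [p J] satisfies the equations of [J], the inequalities in [I] place it in the
    tangent cone of the face of [J] at the face of [I]. *)
Definition tangent_sign I J : int := (-1) ^+ (\dim (W I) + \dim (W J)) *
  ind ((J \subset I)%SET /\ forall i, i \in I -> row_form M i (p J) <= b i 0).

(** The matrix B. For feasible sets the cell is dense in the tangent cone of the face of [J] at that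
    of [I], so testing on it amounts to normality. *)
Definition normal_sign I J : int :=
  ind ((J \subset I)%SET /\ forall h, cell (row_form M) I J h -> dotprod (p I - p J) h <= 0).

(** Both [x - p J] and [x - p K] are orthogonal to [W J], since [W J] lies in [W K]; in their
    difference [x] cancels. *)
Lemma foot_sub J K h : feas J -> feas K -> (K \subset J)%SET -> h \in W J ->
  dotprod (p J - p K) h = 0.
Proof.
move=> /pP[_ Jx] /pP[_ Kx] /fintype.subsetP KJ hJ.
have hK : h \in W K by apply/zerosP => k /KJ; move: k; exact/zerosP.
have -> : p J - p K = (x - p K) - (x - p J) by rewrite [RHS]addrC opprB addrA subrK.
by rewrite dotprodBl Jx// Kx// subr0.
Qed.

(* On cells of the tangent cone, p J - p K is orthogonal to the span, so that
   p I - p J may be replaced by p I - p K: every condition is then expressed by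
   the single vector p K - p I, and cell_relation applies. *)
Lemma normal_tangent I K : feas I -> feas K ->
  \sum_(J in [pred J | `[< feas J >]]) normal_sign I J * tangent_sign J K = (I == K)%:R.
Proof.
move=> fI fK; have [IK|IK] := eqVneq I K.
  subst K; rewrite (bigD1 I)/=; last by rewrite inE.
  rewrite big1 ?addr0; last first.
    move=> J /andP[_ JI]; rewrite /normal_sign /tangent_sign mulrCA mul_ind indF ?mulr0//.
    by move=> [[JI' _] [IJ _]]; case/eqP: JI; apply/eqP; rewrite finset.eqEsubset JI'.
  rewrite /normal_sign /tangent_sign addnn -signr_odd odd_double expr0 mul1r mul_ind indT//.
  split; split=> //; [move=> h _|move=> i iI]; last by rewrite (pP fI).1.
  by rewrite subrr dotprod0l.
have [KI|KI] := boolP (K \subset I)%SET; last first.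
  rewrite big1// => J _; rewrite /normal_sign /tangent_sign mulrCA mul_ind indF ?mulr0//.
  by move=> [[JI _] [KJ _]]; case/negP: KI; exact: fintype.subset_trans JI.
suff [v [w [vK wv vwP]]] : exists v (w : {linear 'cV[R]_d -> R^o}),
    [/\ forall k, k \in K -> row_form M k v = 0, 0 < w v &
     forall J, feas J -> (K \subset J)%SET -> (J \subset I)%SET ->
       ((forall j, j \in J -> row_form M j v <= 0) /\
        (forall h, cell (row_form M) I J h -> 0 <= w h)) <->
       ((forall j, j \in J -> row_form M j (p K) <= b j 0) /\
        (forall h, cell (row_form M) I J h -> dotprod (p I - p J) h <= 0))].
  have E := cell_relation KI vK wv.
  transitivity ((-1) ^+ \dim (W K) * 0 : int); last by rewrite mulr0.
  rewrite -[X in _ = _ * X]E mulr_sumr big_mkcond [RHS]big_mkcond/=; apply: eq_bigr => J _.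
  rewrite inE /normal_sign /tangent_sign mulrCA mul_ind exprD mulrCA mulrA mulrC.
  case: asboolP => fJ; last first.
    case: ifP => // /andP[KJ JI]; rewrite indF ?mulr0// => -[cJ _ _].
    by apply: fJ; apply/(feasible_cell fI).
  case: ifPn => [/andP[KJ JI]|KJI]; last first.
    by rewrite indF ?mul0r// => -[[JI _] [KJ _]]; rewrite KJ JI in KJI.
  rewrite [LHS]mulrC; congr (_ * _); apply: eq_ind.
  split=> [[[_ Jn] [_ Jt]]|[_ Jv Jw]].
    by have [] := (vwP J fJ KJ JI).2 (conj Jt Jn); split=> //; apply/(feasible_cell fI).
  by have [] := (vwP J fJ KJ JI).1 (conj Jv Jw).
have pI i : i \in I -> row_form M i (p K - p I) = row_form M i (p K) - b i 0.
  by move=> iI; rewrite linearB/= (pP fI).1.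
have pK k : k \in K -> row_form M k (p K - p I) = 0.
  by move=> kK; rewrite pI ?(pP fK).1 ?subrr//; exact: (fintype.subsetP KI).
have footN J h : feas J -> (K \subset J)%SET -> cell (row_form M) I J h ->
    dotprod (p K - p I) h = - dotprod (p I - p J) h.
  move=> fJ KJ [/zerosP hJ _]; have := foot_sub fJ fK KJ hJ.
  by rewrite !dotprodBl; lra.
have [pIK|pIK] := eqVneq (p K - p I) 0; last first.
  exists (p K - p I), (dot_form (p K - p I)); split=> // [|J fJ KJ JI].
    exact: dotprod_gt0.
  split=> -[H1 H2]; split=> [j jJ|h ch].
  - by have := H1 _ jJ; rewrite pI ?subr_le0//; exact: (fintype.subsetP JI).
  - by have := H2 _ ch; rewrite /= /dot_form (footN J)// oppr_ge0.
  - by rewrite pI ?subr_le0//; [exact: H1|exact: (fintype.subsetP JI)].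
  - by rewrite /= /dot_form (footN J)// oppr_ge0; exact: H2.
(* The feet coincide, so both foot conditions hold for every [J]. The conditions on [v] and [w] are
   made to hold for every [J] as well: [v] leads from a relative interior point of the face of [I]
   to one of the face of [K], and [w] is minus a row active on the former only. *)
have /subsetPn[i iI iK] : ~~ (I \subset K)%SET.
  by apply: contra IK => IK; rewrite finset.eqEsubset IK.
have [[y Py yI] [z Pz zK]] := (fI, fK).
have yz j : j \in I -> row_form M j (z - y) = row_form M j z - b j 0.
  by move=> jI; rewrite linearB/=; congr (_ - _); apply/activeP; rewrite yI.
exists (z - y), [the {linear 'cV[R]_d -> R^o} of \- (row_form M i)]; split.
- move=> k kK; rewrite yz; last exact: (fintype.subsetP KI).
  by apply/eqP; rewrite subr_eq0; apply/eqP/activeP; rewrite zK.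
- by rewrite /= yz// opprB subr_gt0 lt_inactive// zK.
- move=> J fJ KJ JI; split=> -[_ _]; split=> [j jJ|h ch].
  + by move/eqP: pIK; rewrite subr_eq0 => /eqP ->; rewrite (pP fI).1//; exact: (fintype.subsetP JI).
  + by rewrite -oppr_ge0 -footN// pIK dotprod0l.
  + by rewrite yz ?subr_le0; [exact: Pz|exact: (fintype.subsetP JI)].
  + rewrite /= oppr_ge0; have [iJ|iJ] := boolP (i \in J); first by rewrite ch.1.
    by rewrite ltW// ch.2.
Qed.

Lemma tangent_normal I K : feas I -> feas K ->
  \sum_(J in [pred J | `[< feas J >]]) tangent_sign I J * normal_sign J K = (I == K)%:R.
Proof.
move=> fI fK; apply: (@inverse_in _ [pred J | `[< feas J >]] normal_sign) => [J L||].
- by rewrite !inE => fJ fL; exact: normal_tangent.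
- by rewrite inE.
- by rewrite inE.
Qed.

End Feet.

End Incidence.

(** * Brianchon-Gram relation *)

Lemma regular_scaleE {R : pzRingType} (s : R) (r : R^o) : s *: r = s * r :> R.
Proof. by []. Qed.

Section BrianchonGram.
Context {R : realType} {d m : nat} (M : 'M[R]_(m, d)) (b : 'cV[R]_m).
Implicit Types (I J K : {set 'I_m}) (y z h : 'cV[R]_d) (v : 'cV[R]_d * R^o).

Let P := polyhedron M b.
Let W := zeros (row_form M).

(* The forms of the homogenization {(h, s) : M h <= s b, 0 <= s} of P. *)
Definition hom_form (o : option 'I_m) v : R^o :=
  if o is Some i then row_form M i v.1 - v.2 * b i 0 else - v.2.

Fact hom_form_is_linear o : linear (hom_form o).
Proof.
move=> t [h r] [h' r']; rewrite /hom_form; case: o => [i|] /=.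
  by rewrite linearD linearZ /= !regular_scaleE; ring.
by rewrite !regular_scaleE; ring.
Qed.

HB.instance Definition _ o :=
  GRing.isLinear.Build R ('cV[R]_d * R^o)%type R^o _ (hom_form o) (hom_form_is_linear o).

Definition hom_embed h : 'cV[R]_d * R^o := (h, 0).

Fact hom_embed_is_linear : linear hom_embed.
Proof. by move=> s h h'; congr pair; rewrite /= scaler0 addr0. Qed.

HB.instance Definition _ := GRing.isLinear.Build R 'cV[R]_d
  ('cV[R]_d * R^o)%type _ hom_embed hom_embed_is_linear.

Definition row_sum y : R := \sum_i row_form M i y.

Definition sum_form (t : R) v : R^o := row_sum v.1 + t * v.2.

Fact sum_form_is_linear t : linear (sum_form t).
Proof.
move=> s [h r] [h' r']; rewrite /sum_form /row_sum /= !regular_scaleE.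
under eq_bigr do rewrite linearD linearZ /=.
by rewrite big_split/= -scaler_sumr !regular_scaleE; ring.
Qed.

HB.instance Definition _ t :=
  GRing.isLinear.Build R ('cV[R]_d * R^o)%type R^o _ (sum_form t) (sum_form_is_linear t).

(* On the recession cone of P the form row_sum is nonpositive, and it vanishes
   only on the lineality space: so this says that the recession cone of the face
   with active set I is the lineality space. *)
Definition row_sum_bounded I := exists t, forall y, P y -> active M b y = I -> - t <= row_sum y.

Let H := zeros hom_form.

Let slice (J : {set option 'I_m}) : {set 'I_m} := [set i | Some i \in J]%SET.

Let dim_slice (J : {set option 'I_m}) : \dim (H J :&: lker (linfun snd)) = \dim (W (slice J)).
Proof.
rewrite -(@limg_dim_eq _ _ _ (linfun hom_embed) (W (slice J))); last first.
  apply/eqP; rewrite -subv0; apply/subvP => h; rewrite memv_cap memv_ker lfunE /= => /andP[_].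
  by move=> /eqP[->]; exact: mem0v.
congr (\dim _); apply/vspaceP => -[h r]; rewrite memv_cap memv_ker lfunE /=.
apply/andP/memv_imgP => [[/zerosP hJ /eqP r0]|[h' /zerosP hJ]]; last first.
  rewrite lfunE /= => -[-> ->]; rewrite eqxx; split=> //; apply/zerosP => -[i|] iJ /=.
    by rewrite mul0r subr0 hJ// inE.
  by rewrite oppr0.
exists h; last by rewrite lfunE /= /hom_embed r0.
apply/zerosP => i; rewrite inE => /hJ /=.
by rewrite r0 mul0r subr0.
Qed.

Let dim_zerosT : \dim (H [set: option 'I_m]%SET) = \dim (W [set: 'I_m]%SET).
Proof.
rewrite -(_ : slice [set: _]%SET = [set: _]%SET); last by apply/setP => i; rewrite !inE.
rewrite -dim_slice; congr (\dim _); apply/esym/capv_idPl/subvP => v /zerosP/(_ None).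
by rewrite inE memv_ker lfunE /= => /(_ isT)/eqP; rewrite oppr_eq0.
Qed.

(** Leaving out [None] forces positive height: the cell of [cone_set I] consists of the positive
    multiples of (y, 1) with y in [P] of active set [I]. *)
Let cone_set I : {set option 'I_m} := [set o | if o is Some i then i \in I else false]%SET.

Let slice_cone I : slice (cone_set I) = I.
Proof. by apply/setP => i; rewrite !inE. Qed.

Let dim_cone I : feasible M b I -> \dim (H (cone_set I)) = (\dim (W I)).+1.
Proof.
move=> [y Py yI]; rewrite -(limg_ker_dim (linfun snd) (H (cone_set I))) dim_slice slice_cone.
rewrite -[RHS]addn1; congr addn; apply/eqP; rewrite eqn_leq.
rewrite (leq_trans (dimvS (subvf _))) ?dimvf//=.
rewrite lt0n dimv_eq0; apply/eqP => E.
have : linfun snd ((y, 1) : ('cV[R]_d * R^o)%type) \in (linfun snd @: H (cone_set I))%VS.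
  apply: memv_img; apply/zerosP => -[i|]; rewrite inE// => iI /=.
  by rewrite mul1r; apply/eqP; rewrite subr_eq0; apply/eqP/activeP; rewrite yI.
by rewrite E memv0 lfunE /= oner_eq0.
Qed.

Let cell_cone I v : cell hom_form [set: option 'I_m]%SET (cone_set I) v <->
  [/\ 0 < v.2, P (v.2^-1 *: v.1) & active M b (v.2^-1 *: v.1) = I].
Proof.
have scale i : 0 < v.2 -> row_form M i (v.2^-1 *: v.1) - b i 0 = v.2^-1 * hom_form (Some i) v.
  by move=> v0; rewrite linearZ /= regular_scaleE mulrBr mulKf ?gt_eqF.
split=> [[vI vN]|[v0 Pv vI]].
  have v0 : 0 < v.2.
    by have := vN None; rewrite !inE /= oppr_lt0; exact.
  have vi0 : 0 < v.2^-1 by rewrite invr_gt0.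
  have lti i : i \notin I -> row_form M i (v.2^-1 *: v.1) - b i 0 < 0.
    by move=> iI; rewrite scale// pmulr_rlt0//; apply: vN; rewrite ?inE.
  have eqi i : i \in I -> row_form M i (v.2^-1 *: v.1) - b i 0 = 0.
    by move=> iI; rewrite scale// (vI (Some i)) ?mulr0// inE.
  split=> //.
    apply/polyhedronP => i; rewrite -subr_le0.
    by have [/eqi ->//|/lti/ltW] := boolP (i \in I).
  apply/setP => i; have [iI|iI] := boolP (i \in I).
    by apply/activeP/eqP; rewrite -subr_eq0 eqi.
  by apply/negbTE/negP => /activeP E; have := lti i iI; rewrite E subrr ltxx.
have vi0 : 0 < v.2^-1 by rewrite invr_gt0.
split=> [[i|]|[i|] _]; rewrite inE//.
- move=> iI; have : v.2^-1 * hom_form (Some i) v = 0.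
    by rewrite -scale//; apply/eqP; rewrite subr_eq0; apply/eqP/activeP; rewrite vI.
  by move/eqP; rewrite mulf_eq0 gt_eqF//= => /eqP.
- move=> iI; rewrite -(pmulr_rlt0 _ vi0) -scale// subr_lt0.
  by apply: lt_inactive => //; rewrite vI.
- by rewrite /= oppr_lt0.
Qed.

(** This is [cell_relation] for the homogenization, with direction [(z, 1)] and form [sum_form t].
    The cells over faces give the left side, the lineality space gives the right side, and all other
    cells contribute 0. *)
Lemma brianchon_gram K z : (forall i, i \in K -> row_form M i z = b i 0) ->
  \sum_(I : {set 'I_m} | (K \subset I)%SET) (-1) ^+ \dim (W I) *
     ind [/\ feasible M b I, row_sum_bounded I & forall i, i \in I -> row_form M i z <= b i 0]
  = (-1) ^+ \dim (W [set: 'I_m]%SET) * ind (P z).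
Proof.
move=> zK.
(* For t large, sum_form t is nonnegative on the cone over a bounded-below face
   and on no other cell, except the lineality space. *)
have [t tz tb] : exists2 t, 0 < sum_form t (z, 1) & forall I, row_sum_bounded I ->
    forall y, P y -> active M b y = I -> - t <= row_sum y.
  have tb : \forall t \near (+oo : set_system R), forall I, row_sum_bounded I ->
      forall y, P y -> active M b y = I -> - t <= row_sum y.
    apply: filter_forall => I; have [[t tI]|nI] := pselect (row_sum_bounded I); last exact: nearW.
    near=> s => _ y Py yI; apply: le_trans (tI y Py yI); rewrite lerN2.
    by near: s; exact: nbhs_pinfty_ge (num_real _).
  near (+oo : set_system R) => t; exists t; last by near: t; exact: tb.
  rewrite /sum_form /= mulr1 addrC -ltrBlDr sub0r.
  by near: t; exact: nbhs_pinfty_gt (num_real _).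
have KT : (cone_set K \subset [set: option 'I_m])%SET by exact: finset.subsetT.
have zK' o : o \in cone_set K -> hom_form o (z, 1) = 0.
  by case: o => [i|]; rewrite inE//= => /zK ->; rewrite mul1r subrr.
have := cell_relation KT zK' tz.
rewrite (bigID (fun J : {set option 'I_m} => None \in J))/=.
rewrite (bigD1 [set: option 'I_m]%SET) ?inE ?finset.subsetT//=.
(* At height 0, outside the lineality space, all rows are nonpositive and one is negative, so
   [sum_form t] is negative there. *)
rewrite [X in _ + X + _]big1 ?addr0; last first.
  move=> J /andP[/andP[_ NJ] JT]; apply/eqP; rewrite mulf_eq0 signr_eq0/=; apply/eqP.
  apply: indF => -[[v [vJ vN]] _ wv].
  have v2 : v.2 = 0 by have /eqP := vJ None NJ; rewrite /= oppr_eq0 => /eqP.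
  have le0 i : row_form M i v.1 <= 0.
    have <- : hom_form (Some i) v = row_form M i v.1 by rewrite /= v2 mul0r subr0.
    have [iJ|iJ] := boolP (Some i \in J); first by rewrite vJ.
    by rewrite ltW// vN// inE.
  have /subsetPn[[i|] _ iJ] : ~~ ([set: option 'I_m] \subset J)%SET.
    by apply: contra JT => JT; rewrite finset.eqEsubset finset.subsetT JT.
  - have := wv v (conj vJ vN); rewrite leNgt => /negP; apply.
    rewrite /= /sum_form v2 mulr0 addr0 /row_sum (bigD1 i)//= -[ltRHS]addr0 ltr_leD//.
      have <- : hom_form (Some i) v = row_form M i v.1 by rewrite /= v2 mul0r subr0.
      by apply: vN; rewrite ?inE.
    by apply: sumr_le0 => j _; exact: le0.
  - by rewrite NJ in iJ.
rewrite dim_zerosT.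
have -> : ind [/\ cell hom_form [set: option 'I_m]%SET [set: option 'I_m]%SET !=set0,
     forall j, j \in [set: option 'I_m]%SET -> hom_form j (z, 1) <= 0
   & forall v, cell hom_form [set: option 'I_m]%SET [set: option 'I_m]%SET v ->
       0 <= sum_form t v] = ind (P z).
  apply: eq_ind; split=> [[_ zP _]|zP].
    apply/polyhedronP => i; have := zP (Some i); rewrite inE /= mul1r subr_le0; exact.
  split=> [|[i|] _|v [vT _]].
  - by exists 0; split=> [j _|j _]; rewrite ?inE// linear0.
  - by rewrite /= mul1r subr_le0; exact: zP.
  - by rewrite /= oppr_le0.
  - have v2 : v.2 = 0 by have /eqP := vT None (finset.in_setT _); rewrite /= oppr_eq0 => /eqP.
    rewrite /= /sum_form v2 mulr0 addr0 /row_sum big1// => i _.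
    by have := vT (Some i) (finset.in_setT _); rewrite /= v2 mul0r subr0.
rewrite (reindex_onto cone_set slice)/=; last first.
  by move=> J /andP[_ NJ]; apply/setP => -[i|]; rewrite !inE// (negbTE NJ).
move/eqP; rewrite addr_eq0 => /eqP ->; rewrite -sumrN; apply: eq_big => [I|I KI].
  rewrite slice_cone eqxx finset.subsetT inE !andbT.
  apply/fintype.subsetP/fintype.subsetP => [KI [i|]|KI i iK]; rewrite ?inE//; first exact: KI.
  by have := KI (Some i); rewrite !inE; exact.
have indE : ind [/\ feasible M b I, row_sum_bounded I &
     forall i, i \in I -> row_form M i z <= b i 0] =
   ind [/\ cell hom_form [set: option 'I_m]%SET (cone_set I) !=set0,
     forall j, j \in cone_set I -> hom_form j (z, 1) <= 0
   & forall v, cell hom_form [set: option 'I_m]%SET (cone_set I) v -> 0 <= sum_form t v].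
  have cell1 y : P y -> active M b y = I ->
      cell hom_form [set: option 'I_m]%SET (cone_set I) (y, 1).
    by move=> Py yI; apply/cell_cone; rewrite /= invr1 scale1r; split.
  apply: eq_ind; split=> [[[y Py yI] bI zI]|[[v /cell_cone[v0 Pv vI]] zI wI]]; split.
  - by exists (y, 1); exact: cell1.
  - by case=> [i|]; rewrite inE//= => /zI; rewrite mul1r subr_le0.
  - move=> v /cell_cone[v0 Pv vI]; have := tb I bI _ Pv vI.
    have -> : row_sum (v.2^-1 *: v.1) = v.2^-1 * row_sum v.1.
      by rewrite /row_sum mulr_sumr; apply: eq_bigr => i _; rewrite linearZ.
    rewrite mulrC ler_pdivlMr// mulNr /= /sum_form; lra.
  - by exists (v.2^-1 *: v.1).
  - exists t => y Py yI; have := wI _ (cell1 y Py yI).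
    by rewrite /= /sum_form mulr1; lra.
  - by move=> i iI; have := zI (Some i); rewrite inE /= mul1r subr_le0; exact.
rewrite -indE; case: (pselect (feasible M b I)) => [fI|fI]; last first.
  by rewrite indF ?mulr0 ?oppr0// => -[].
(* The extra dimension of the cone cancels the sign from moving the sum to the other side. *)
by rewrite dim_cone// exprS mulN1r mulNr opprK.
Unshelve. all: by end_near. Qed.

End BrianchonGram.

(** * Faces and active sets *)

Section FootSum.
Context {R : realType} {d m : nat} (M : 'M[R]_(m, d)) (b : 'cV[R]_m).
Implicit Types (I J K : {set 'I_m}).

Let W := zeros (row_form M).
Let D := [pred J | `[< feasible M b J >]].

(** By [brianchon_gram] at [p J], each signed indicator of [p J] in the polyhedron is the entry at
    [J] of c A, so the sum is the entry at [K] of c A B = c. *)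
Lemma sum_feet (x : 'cV[R]_d) (p : {set 'I_m} -> 'cV[R]_d) K :
  (forall I, feasible M b I -> (forall i, i \in I -> row_form M i (p I) = b i 0) /\
     (forall h, h \in W I -> dotprod (x - p I) h = 0)) ->
  feasible M b K ->
  \sum_(J in D) (-1) ^+ \dim (W J) * ind (polyhedron M b (p J)) * normal_sign M p J K =
  (-1) ^+ \dim (W [set: 'I_m]%SET) * ind (row_sum_bounded M b K).
Proof.
move=> pP fK.
pose c I : int := (-1) ^+ \dim (W [set: 'I_m]%SET) * ind (row_sum_bounded M b I).
have cE J : J \in D -> (-1) ^+ \dim (W J) * ind (polyhedron M b (p J)) =
    \sum_(I in D) c I * tangent_sign M b p I J.
  rewrite inE => fJ.
  have := brianchon_gram (pP J fJ).1.
  move=> /(congr1 ( *%R ((-1) ^+ \dim (W [set: 'I_m]%SET) * (-1) ^+ \dim (W J)))).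
  rewrite /= [RHS]mulrACA -expr2 sqrr_sign mul1r => <-.
  rewrite mulr_sumr big_mkcond [RHS]big_mkcond/=; apply: eq_bigr => I _.
  rewrite inE /c /tangent_sign; case: asboolP => fI; last first.
    by case: ifP => // _; rewrite indF ?mulr0// => -[].
  case: ifPn => JI; last by rewrite [X in _ * (_ * X)]indF ?mulr0// => -[].
  rewrite [RHS]mulrACA mul_ind exprD [LHS]mulrA -[X in X * _ = _]mulrA [X in _ * X * _ = _]mulrC.
  congr (_ * _).
  by apply: eq_ind; split=> [[_ ? ?]|[? [_ ?]]].
rewrite (eq_bigr (fun J => \sum_(I in D) c I * (tangent_sign M b p I J * normal_sign M p J K))).
  rewrite exchange_big/= (bigD1 K)/=; last exact/asboolP.
  rewrite [X in _ + X]big1 ?addr0; last first.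
    move=> I /andP[/asboolP fI IK]; rewrite -mulr_sumr (tangent_normal pP)//.
    by rewrite (negbTE IK) mulr0.
  by rewrite -mulr_sumr (tangent_normal pP)// eqxx mulr1.
move=> J JD; rewrite cE// mulr_suml; apply: eq_bigr => I _; exact/esym/mulrA.
Qed.

End FootSum.

Section Faces.
Context {R : realType} {d m : nat} (M : 'M[R]_(m, d)) (b : 'cV[R]_m).
Implicit Types (I J K : {set 'I_m}) (x y z h u : 'cV[R]_d).

Let P := polyhedron M b.
Let W := zeros (row_form M).

Definition face_of I : set 'cV[R]_d := [set y | P y /\ (I \subset active M b y)%SET].

Lemma active_midpoint y z : P y -> P z ->
  P (2^-1 *: (y + z)) /\
  active M b (2^-1 *: (y + z)) = (active M b y :&: active M b z)%SET.
Proof.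
move=> Py Pz.
have rE i : row_form M i (2^-1 *: (y + z)) = 2^-1 * (row_form M i y + row_form M i z).
  by rewrite linearZ/= linearD.
have Py' i : row_form M i y <= b i 0 by exact: Py.
have Pz' i : row_form M i z <= b i 0 by exact: Pz.
split.
  by apply/polyhedronP => i; rewrite rE; have := Py' i; have := Pz' i; lra.
apply/setP => i; rewrite finset.in_setI; apply/activeP/andP => [|[/activeP Ey /activeP Ez]].
  rewrite rE => E; split; apply/activeP; have := Py' i; have := Pz' i; lra.
by rewrite rE Ey Ez; lra.
Qed.

(** The sum of the rows in [I] is a supporting functional: on [P] it attains the sum of the bounds
    exactly where every inequality in [I] is tight. *)
Lemma feasible_face I : feasible M b I -> faces P (face_of I).
Proof.
move=> [y Py yI]; split; first by exists y; split=> //; rewrite yI.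
pose u : 'cV[R]_d := \sum_(i in I) (row i M)^T.
have uE z : dotprod u z = \sum_(i in I) row_form M i z.
  rewrite dotprodC -[LHS]/(dot_form z u) linear_sum; apply: eq_bigr => i _.
  by rewrite /= /dot_form /row_form mxE; apply: eq_bigr => j _; rewrite !mxE mulrC.
exists u, (\sum_(i in I) b i 0); split=> [z Pz|].
  by rewrite uE; apply: ler_sum => i _; exact: Pz.
apply/seteqP; split=> z [Pz].
  move=> /fintype.subsetP Iz; split=> //; rewrite uE; apply: eq_bigr => i /Iz.
  by move/activeP.
rewrite uE => E; split=> //; apply/fintype.subsetP => i iI; apply/activeP.
have : \sum_(j in I) (b j 0 - row_form M j z) = 0 by rewrite sumrB E subrr.
move/eqP; rewrite psumr_eq0; last by move=> j _; rewrite subr_ge0; exact: Pz.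
by move/allP/(_ i (mem_index_enum _))/implyP/(_ iI); rewrite subr_eq0 => /eqP.
Qed.

(** Midpoints show that a point [y] of [F] with fewest active inequalities has its active set
    contained in that of every point of [F]. Conversely, if the inequalities active at [y] are tight
    at [z], then [P] contains points slightly beyond [y] on the line from [z], so the functional at
    [z] cannot be below its maximum [c]. *)
Lemma face_feasible F : faces P F -> exists2 I, feasible M b I & F = face_of I.
Proof.
move=> [[x0 Fx0] [u [c [Pc FE]]]].
have [y Fy ymin] : exists2 y, F y & forall z, F z -> (active M b y \subset active M b z)%SET.
  have ex : exists n, `[< exists2 y, F y & #|active M b y| = n >].
    by exists #|active M b x0|; apply/asboolP; exists x0.
  case: (ex_minnP ex) => n /asboolP[y Fy yn] nmin; exists y => // z Fz.
  have [[Py uy] [Pz uz]] : (P y /\ dotprod u y = c) /\ (P z /\ dotprod u z = c).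
    by move: Fy Fz; rewrite FE.
  have [Pq qE] := active_midpoint Py Pz.
  have /nmin : `[< exists2 q, F q & #|active M b q| = #|active M b (2^-1 *: (y + z))| >].
    apply/asboolP; exists (2^-1 *: (y + z)) => //; rewrite FE; split=> //.
    by rewrite dotprodZr dotprodDr uy uz; lra.
  rewrite -yn qE => le; apply/finset.setIidPl/eqP.
  by rewrite eqEcard finset.subsetIl.
exists (active M b y).
  by exists y => //; move: Fy; rewrite FE => -[].
apply/seteqP; split=> [z Fz|z [Pz yz]].
  by split; [move: Fz; rewrite FE => -[]|exact: ymin].
have [Py uy] : P y /\ dotprod u y = c by move: Fy; rewrite FE.
have cz : cell (row_form M) (active M b y) (active M b y) (y - z).
  split=> [i iy|i -> //]; rewrite linearB /= (activeP _ _ _ _ iy).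
  by rewrite (activeP _ _ _ _ (fintype.subsetP yz _ iy)) subrr.
rewrite FE; split=> //; apply/le_anti; rewrite Pc//=.
near (0 : R)^'+ => s.
have s0 : 0 < s by near: s; exact: near0_gt0.
have Ps : P (y + s *: (y - z)).
  by near: s; apply: filterS (near_active Py (fintype.subxx _) cz) => s [].
have := Pc _ Ps; rewrite dotprodDr dotprodZr dotprodDr -scaleN1r dotprodZr uy.
by rewrite gerDl pmulr_rle0// mulN1r subr_le0.
Unshelve. all: by end_near. Qed.

Lemma face_of_inj I J : feasible M b I -> feasible M b J -> face_of I = face_of J -> I = J.
Proof.
move=> [y Py yI] [z Pz zJ] E.
have [_ JI] : face_of J y by rewrite -E; split=> //; rewrite yI.
have [_ IJ] : face_of I z by rewrite E; split=> //; rewrite zJ.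
by apply/eqP; rewrite finset.eqEsubset -{1}zJ IJ -{1}yI JI.
Qed.

Lemma affine_hull_line (A : set 'cV[R]_d) y z (t : R) : A y -> A z ->
  affine_hull A (y + t *: (z - y)).
Proof.
move=> Ay Az; exists 2%N, (fun i : 'I_2 => if i == ord0 then 1 - t else t),
  (fun i : 'I_2 => if i == ord0 then y else z); split.
- by move=> i; case: ifP.
- by rewrite big_ord_recl big_ord1 /= subrK.
- rewrite big_ord_recl big_ord1 /= scalerBl scale1r scalerBr.
  by rewrite addrAC addrA.
Qed.

Lemma affine_hull_row I y : affine_hull (face_of I) y ->
  forall i, i \in I -> row_form M i y = b i 0.
Proof.
move=> [n [a [q [qI a1 ->]]]] i iI; rewrite linear_sum.
rewrite (eq_bigr (fun k => a k * b i 0)); first by rewrite -mulr_suml a1 mul1r.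
move=> k _; rewrite linearZ /=; congr (_ * _).
by apply/activeP; apply: (fintype.subsetP (qI k).2).
Qed.

Lemma near_face y h I : P y -> active M b y = I -> h \in W I ->
  \forall s \near (0 : R)^'+, face_of I (y + s *: h).
Proof.
move=> Py yI /zerosP hI; subst I.
have ch : cell (row_form M) (active M b y) (active M b y) h.
  by split=> // i ->.
by apply: filterS (near_active Py (fintype.subxx _) ch) => s [Ps sE]; split=> //; rewrite sE.
Qed.

(** A short step from [y] along any [h] in [W I] stays in the face; scaling that step back up
    reaches [y + h]. *)
Lemma affine_hull_face I y : P y -> active M b y = I ->
  affine_hull (face_of I) = [set y + h | h in [set` W I]].
Proof.
move=> Py yI; apply/seteqP; split=> [z zI|_ [h /= hI <-]].
  exists (z - y); last by rewrite addrC subrK.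
  apply/zerosP => i iI; rewrite linearB /= (affine_hull_row zI iI).
  by rewrite -yI in iI; rewrite (activeP _ _ _ _ iI) subrr.
near (0 : R)^'+ => s.
have s0 : 0 < s by near: s; exact: near0_gt0.
have Fs : face_of I (y + s *: h) by near: s; exact: near_face.
have Fy : face_of I y by split=> //; rewrite yI.
have := affine_hull_line s^-1 Fy Fs.
by rewrite (addrC y (s *: h)) addrK scalerA mulVf ?gt_eqF// scale1r.
Unshelve. all: by end_near. Qed.

(** [affine_dim] picks some dimension, so the direction space has to be shown unique;
    [affine_hull_face] excludes the dummy value. *)
Lemma affine_dim_face I : feasible M b I -> affine_dim (face_of I) = \dim (W I).
Proof.
move=> [y Py yI]; rewrite /affine_dim; case: xgetP => [k _ [q [U [E ->]]]|]; last first.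
  by move=> /(_ (\dim (W I)))[]; exists y, (W I); rewrite (affine_hull_face Py yI).
move: E; rewrite (affine_hull_face Py yI) => E; congr (\dim _).
have mem v : ([set y + h | h in [set` W I]] v) <-> v - y \in W I.
  split=> [[h hW <-]|vW]; first by rewrite addrC addKr.
  by exists (v - y) => //; rewrite addrC subrK.
have memU v : ([set q + h | h in [set` U]] v) <-> v - q \in U.
  split=> [[h hW <-]|vW]; first by rewrite addrC addKr.
  by exists (v - q) => //; rewrite addrC subrK.
have yq : y - q \in U by apply/memU; rewrite -E; apply/mem; rewrite subrr mem0v.
apply/esym/vspaceP => h; apply/idP/idP => hU.
  have : (y + h) - q \in U by apply/memU; rewrite -E; apply/mem; rewrite addrC addKr.
  by rewrite addrAC rpredDl.
have : (y + h) - y \in W I by apply/mem; rewrite E; apply/memU; rewrite addrAC rpredDl.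
by rewrite addrC addKr.
Qed.

End Faces.

(** * Norms, relative interiors and normal cones *)

Section MatrixNorm.
Context {R : realType} {d : nat}.
Implicit Types (x y h : 'cV[R]_d).

Lemma coord_le_norm x i : `|x i 0| <= `|x|.
Proof.
rewrite [leRHS]mx_normrE.
exact: (@le_bigmax _ _ _ 0 (fun ij : 'I_d * 'I_1 => `|x ij.1 ij.2|) (i, 0)).
Qed.

Lemma norm_le_coord x (C : R) : 0 <= C -> (forall i, `|x i 0| <= C) -> `|x| <= C.
Proof.
move=> C0 xC; rewrite [leLHS]mx_normrE; apply: bigmax_le => // -[i j] _ /=.
by rewrite ord1.
Qed.

(** Passes from topological neighbourhoods, as in [relint], to one-sided germs along lines. *)
Lemma near_line (A : set 'cV[R]_d) y h : (\forall z \near y, A z) ->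
  \forall s \near (0 : R)^'+, A (y + s *: h).
Proof.
move=> /nbhs_ballP[e /= e0 eA].
have e0' : 0 < e / (1 + `|h|) by rewrite divr_gt0// ltr_pwDl.
near=> s; apply: eA; rewrite -ball_normE /= opprD addNKr normrN normrZ.
have s0 : 0 < s by near: s; exact: near0_gt0.
rewrite gtr0_norm//; apply: (@le_lt_trans _ _ (s * (1 + `|h|))).
  by rewrite ler_pM2l// lerDr.
by rewrite -ltr_pdivlMr ?ltr_pwDl//; near: s; exact: near0_lt e0'.
Unshelve. all: by end_near. Qed.

End MatrixNorm.

Lemma row_form_le_norm {R : realType} {d m : nat} (M : 'M[R]_(m, d)) i (y : 'cV[R]_d) :
  `|row_form M i y| <= (\sum_j `|M i j|) * `|y|.
Proof.
rewrite /row_form mxE (le_trans (ler_norm_sum _ _ _))// mulr_suml.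
by apply: ler_sum => j _; rewrite normrM ler_wpM2l// coord_le_norm.
Qed.

Section NormalCones.
Context {R : realType} {d m : nat} (M : 'M[R]_(m, d)) (b : 'cV[R]_m).
Implicit Types (I J K : {set 'I_m}) (x y z h u : 'cV[R]_d).

Let P := polyhedron M b.
Let W := zeros (row_form M).

(** Near [y] the inequalities outside [I] remain strict, and on the affine hull those in [I] are
    equalities. *)
Lemma relint_face I y : P y -> active M b y = I -> relint (face_of M b I) y.
Proof.
move=> Py yI; split; first by split=> //; rewrite yI.
suff : \forall z \near y, forall i, i \notin I -> row_form M i z < b i 0.
  apply: filterS => z zI /affine_hull_row zE; split.
    by apply/polyhedronP => i; have [/zE ->//|/zI/ltW] := boolP (i \in I).
  by apply/fintype.subsetP => i /zE/activeP.
apply: (@filter_forall _ _ (fun i z => i \notin I -> row_form M i z < b i 0) (nbhs y)) => i.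
have [iI|iI] := boolP (i \in I); first exact: nearW.
have e0 : 0 < b i 0 - row_form M i y by rewrite subr_gt0 lt_inactive// yI.
have C0 : 0 < 1 + \sum_j `|M i j| by rewrite ltr_pwDl// sumr_ge0.
have e0' : 0 < (b i 0 - row_form M i y) / (1 + \sum_j `|M i j|) by rewrite divr_gt0.
apply: filterS (nbhsx_ballx y _ e0') => z; rewrite -ball_normE /= ltr_pdivlMr// => zy _.
have := row_form_le_norm M i (y - z); have := ler_norm (- row_form M i (y - z)).
have : row_form M i (y - z) = row_form M i y - row_form M i z by rewrite linearB.
have := normr_ge0 (y - z); rewrite normrN; lra.
Qed.

(** From a relative interior point [y] the face contains a short step away from [y'], so normality
    at [y] bounds [dotprod u (y - y')]. A vector normal at one such point is thus normal at every
    point of the face. *)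
Lemma relint_normal_cone I y u z y' : relint (face_of M b I) y -> normal_cone P y u ->
  P z -> face_of M b I y' -> dotprod u (z - y') <= 0.
Proof.
move=> [Fy nearF] uy Pz Fy'.
suff : dotprod u (y - y') <= 0.
  move=> yy'; have -> : z - y' = (z - y) + (y - y') by rewrite addrA subrK.
  by rewrite dotprodDr; have := uy z Pz; lra.
near (0 : R)^'+ => s.
have s0 : 0 < s by near: s; exact: near0_gt0.
have [Ps _] : face_of M b I (y + s *: (y - y')).
  have : affine_hull (face_of M b I) (y + s *: (y - y')).
    by rewrite -opprB scalerN -scaleNr; exact: affine_hull_line.
  near: s; move: nearF.
  exact: (@near_line _ _ (fun z => affine_hull (face_of M b I) z -> face_of M b I z)).
by have := uy _ Ps; rewrite addrC addKr dotprodZr pmulr_rle0.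
Unshelve. all: by end_near. Qed.

(** In [x = y - u] the normal vector [u] is orthogonal to [W I], which forces [y = p I] and
    [u = p I - x]. Replacing [x] by [p J], its foot on the affine hull of [P], changes nothing on
    cells, whose vectors lie in [W J]. *)
Lemma face_diff_normal_cone x (p : {set 'I_m} -> 'cV[R]_d) I J :
  (forall I, feasible M b I -> (forall i, i \in I -> row_form M i (p I) = b i 0) /\
     (forall h, h \in W I -> dotprod (x - p I) h = 0)) ->
  feasible M b I -> feasible M b J -> (forall I, feasible M b I -> (J \subset I)%SET) ->
  minkowski_diff (face_of M b I) (face_normal_cone P (face_of M b I)) x <->
  P (p I) /\ forall h, cell (row_form M) I J h -> dotprod (p I - p J) h <= 0.
Proof.
move=> pP fI fJ Jmin; have [pI xI] := pP I fI; have [_ xJ] := pP J fJ.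
have shift h : cell (row_form M) I J h -> dotprod (p I - p J) h = dotprod (p I - x) h.
  move=> [/zerosP hJ _]; have := xJ h hJ; rewrite !dotprodBl; lra.
have [y0 Py0 y0I] := fI; have Fy0 : face_of M b I y0 by split=> //; rewrite y0I.
split=> [[y Fy [u [y1 y1r uy1] xE]]|[Pp pc]].
  have uN z y' : P z -> face_of M b I y' -> dotprod u (z - y') <= 0.
    exact: relint_normal_cone y1r uy1.
  have u0 h : h \in W I -> dotprod u h = 0.
    move=> hI; near (0 : R)^'+ => s.
    have s0 : 0 < s by near: s; exact: near0_gt0.
    have Fs : face_of M b I (y0 + s *: h) by near: s; exact: near_face.
    have := uN _ _ Fs.1 Fy0; have := uN _ _ Fy0.1 Fs.
    rewrite opprD addNKr -scaleNr dotprodZr mulNr oppr_le0 addrC addKr dotprodZr.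
    by rewrite pmulr_rge0// pmulr_rle0// => u1 u2; apply/le_anti/andP.
  have yp : y = p I.
    apply/eqP; rewrite -subr_eq0; apply: contraT => /dotprod_gt0.
    have ypW : y - p I \in W I.
      apply/zerosP => i iI; rewrite linearB /= pI//.
      by rewrite (activeP _ _ _ _ (fintype.subsetP Fy.2 _ iI)) subrr.
    have E : y - p I = u + (x - p I) by rewrite -xE !addrA [u + y]addrC addrK.
    by rewrite {1}E dotprodC dotprodDr !(dotprodC (y - p I)) u0// xI// addr0 ltxx.
  have uE : u = p I - x by rewrite -xE -yp opprB addrC subrK.
  split; first by rewrite -yp; exact: Fy.1.
  move=> h ch; rewrite shift// -uE; near (0 : R)^'+ => s.
  have s0 : 0 < s by near: s; exact: near0_gt0.
  have Ps : P (y0 + s *: h).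
    near: s; have JI : (J \subset active M b y0)%SET by rewrite y0I; exact: Jmin.
    by rewrite -y0I in ch; apply: filterS (near_active Py0 JI ch) => s [].
  by have := uN _ _ Ps Fy0; rewrite addrC addKr dotprodZr pmulr_rle0.
exists (p I).
  by split=> //; apply/fintype.subsetP => i /pI/activeP.
exists (p I - x); last by rewrite opprB addrC subrK.
exists y0; first exact: relint_face.
(* [z - y0] may lie on the boundary of the tangent cone. Adding a small multiple of [z0 - y0], with
   [z0] in the relative interior of [P], moves it into the open cell and keeps the scalar product
   positive. *)
move=> z Pz; have [z0 Pz0 z0J] := fJ.
rewrite leNgt; apply/negP => pos.
have : - dotprod (p I - x) (z - y0) < 0 by rewrite oppr_lt0.
move=> /near0_lt_form-/(_ (- dotprod (p I - x) (z0 - y0))) neg.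
near (0 : R)^'+ => s.
have s0 : 0 < s by near: s; exact: near0_gt0.
have ch : cell (row_form M) I J ((z - y0) + s *: (z0 - y0)).
  split=> [j jJ|i iI iJ]; rewrite formD !linearB /=.
    have E w : P w -> row_form M j w = b j 0.
      move=> Pw; apply/activeP.
      have /Jmin/fintype.subsetP : feasible M b (active M b w) by exists w.
      exact.
    by rewrite !E// subrr mulr0 addr0.
  have -> : row_form M i y0 = b i 0 by apply/activeP; rewrite y0I.
  have z0i : row_form M i z0 - b i 0 < 0 by rewrite subr_lt0 lt_inactive// z0J.
  have zi : row_form M i z - b i 0 <= 0 by rewrite subr_le0; exact: Pz.
  by have : s * (row_form M i z0 - b i 0) < 0; [rewrite pmulr_rlt0|lra].
have := pc _ ch; rewrite shift// dotprodDr dotprodZr.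
suff : - dotprod (p I - x) (z - y0) + s * - dotprod (p I - x) (z0 - y0) < 0 by lra.
by near: s; exact: neg.
Unshelve. all: by end_near. Qed.

End NormalCones.

(** * The value of phi_P and boundedness *)

Section Value.
Context {R : realType} {d m : nat} (M : 'M[R]_(m, d)) (b : 'cV[R]_m).
Implicit Types (I J K : {set 'I_m}) (x y z h u : 'cV[R]_d).

Let P := polyhedron M b.
Let W := zeros (row_form M).

(** [J] is the set of implicit equations of the system, found as the index of [P] as a face of
    itself. *)
Lemma min_feasible : P !=set0 ->
  exists2 J, feasible M b J & forall I, feasible M b I -> (J \subset I)%SET.
Proof.
move=> P0.
have PP : faces P P.
  split=> //; exists 0, 0; split=> [x _|]; first by rewrite dotprod0l.
  by apply/seteqP; split=> [x Px|x []//]; rewrite /= dotprod0l.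
have [J fJ PE] := face_feasible PP; exists J => // I [y Py <-].
by have [] : face_of M b J y by rewrite -PE.
Qed.

(** The faces are reindexed by their active sets; as [J] is the index of [P] itself, the normality
    conditions form the column of B at [J]. *)
Lemma varphi_active (p : {set 'I_m} -> 'cV[R]_d) x J :
  (forall I, feasible M b I -> (forall i, i \in I -> row_form M i (p I) = b i 0) /\
     (forall h, h \in W I -> dotprod (x - p I) h = 0)) ->
  feasible M b J -> (forall I, feasible M b I -> (J \subset I)%SET) ->
  varphi P x = \sum_(I in [pred I | `[< feasible M b I >]])
    (-1) ^+ \dim (W I) * ind (P (p I)) * normal_sign M p I J.
Proof.
move=> pP fJ Jmin; rewrite /varphi.
rewrite (@reindex_fsbig _ _ _ _ _ (face_of M b) [set I | feasible M b I]); last first.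
  split=> [I fI|I K|F /face_feasible[I fI ->]]; first exact: feasible_face.
    by rewrite !inE; exact: face_of_inj.
  by exists I.
rewrite (fsbigE (enum [pred I | `[< feasible M b I >]])) ?enum_uniq//; first last.
- by move=> I fI; rewrite mem_enum inE => /asboolPn[].
- by move=> I /=; rewrite mem_enum inE.
rewrite big_mkcond big_enum/=; apply: eq_bigr => I; rewrite inE => fI.
rewrite mem_set//= affine_dim_face// -mulrA mul_ind; congr (_ * _).
rewrite indicE; set D := minkowski_diff _ _; transitivity (ind (D x)).
  by have [xD|xD] := pselect (D x); [rewrite mem_set// indT|rewrite memNset// indF].
apply: eq_ind; rewrite /D (face_diff_normal_cone pP fI fJ Jmin); split=> [[? ?]|[? []//]].
by split=> //; split=> //; exact: Jmin.
Qed.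

(** The feet depend on [x], but [sum_feet] evaluates the sum to an expression free of them. *)
Lemma varphi_value J x :
  feasible M b J -> (forall I, feasible M b I -> (J \subset I)%SET) ->
  varphi P x = (-1) ^+ \dim (lineality M) * ind (row_sum_bounded M b J).
Proof.
move=> fJ Jmin.
have [p pP] := feet_exist M b x.
by rewrite (varphi_active pP fJ Jmin) (sum_feet pP fJ) zeros_row_formT.
Qed.

Lemma linealityP h : reflect (forall i, row_form M i h = 0) (h \in lineality M).
Proof.
rewrite -zeros_row_formT; apply: (iffP (zerosP _ _ _)) => [h0 i|h0 i _]; last exact: h0.
by apply: h0; rewrite inE.
Qed.

(** The midpoint of [z] and a relative interior point [z0] has active set [J], so the bound on the
    relative interior extends to all of [P]. *)
Lemma row_sum_lower_bound J (t : R) z z0 : (J \subset active M b z)%SET ->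
  (forall y, P y -> active M b y = J -> - t <= row_sum M y) ->
  P z -> P z0 -> active M b z0 = J -> - (2 * t) - row_sum M z0 <= row_sum M z.
Proof.
move=> Jz tJ Pz Pz0 z0J; have [Pq qJ] := active_midpoint Pz Pz0.
have := tJ _ Pq; rewrite qJ z0J; have /finset.setIidPr -> := Jz => /(_ erefl).
have -> : row_sum M (2^-1 *: (z + z0)) = 2^-1 * (row_sum M z + row_sum M z0).
  rewrite /row_sum -big_split mulr_sumr; apply: eq_bigr => i _.
  by rewrite linearZ /= linearD.
by lra.
Qed.

(* With g the vector on the right, g - z is in the lineality space, hence
   orthogonal to z. *)
Lemma orthogonal_le_pinvmx z : orthogonal_complement (lineality M) z ->
  dotprod z z <= dotprod (pinvmx M *m (M *m z)) (pinvmx M *m (M *m z)).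
Proof.
set g := pinvmx M *m _ => zU.
have gU : g - z \in lineality M.
  apply/linealityP => i; rewrite /row_form mulmxBr /g (mulmxA M (pinvmx M)) (mulmxA _ M z).
  by rewrite (mulmxKpV (submx_refl M)) subrr mxE.
have := zU _ gU; rewrite dotprodC dotprodBl => zg.
have : 0 <= dotprod (g - z) (g - z).
  by have [->|/dotprod_gt0/ltW//] := eqVneq (g - z) 0; rewrite dotprod0l.
rewrite dotprodBl !(dotprodC _ (g - z)) !dotprodBl (dotprodC z g); lra.
Qed.

(** Every row is bounded above on [P], so a lower bound for the sum bounds each row in absolute
    value; the generalized inverse [pinvmx M] then bounds the points orthogonal to the lineality
    space. Conversely, subtracting the lineality component of [y] changes no row. *)
Lemma row_sum_boundedP J :
  feasible M b J -> (forall I, feasible M b I -> (J \subset I)%SET) ->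
  row_sum_bounded M b J <-> bounded_set (P `&` orthogonal_complement (lineality M)).
Proof.
move=> [z0 Pz0 z0J] Jmin; split=> [[t tJ]|].
  pose B := `|- (2 * t) - row_sum M z0| + \sum_i `|b i 0|.
  have B0 : 0 <= B by rewrite addr_ge0// sumr_ge0.
  pose N := \sum_k \sum_i `|pinvmx M k i| * B.
  have rowB z i : P z -> `|row_form M i z| <= B.
    move=> Pz; have Pz' k : row_form M k z <= b k 0 by exact: Pz.
    have Jz : (J \subset active M b z)%SET by apply: Jmin; exists z.
    have := row_sum_lower_bound Jz tJ Pz Pz0 z0J.
    have -> : row_sum M z = row_form M i z + \sum_(k | k != i) row_form M k z.
      by rewrite /row_sum (bigD1 i).
    rewrite /B [\sum_i0 `|b i0 0|](bigD1 i)//=.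
    have rs : \sum_(k | k != i) row_form M k z <= \sum_(k | k != i) `|b k 0| :> R.
      by apply: ler_sum => k _; rewrite (le_trans (Pz' k))// ler_norm.
    move: rs; set r := \sum_(k | _) row_form _ _ z; set s := \sum_(k | _) `|_| => rs.
    have s0 : 0 <= s by rewrite sumr_ge0.
    have := Pz' i; have := ler_norm (b i 0); have := normr_ge0 (b i 0).
    set T := - (2 * t) - _; have := ler_norm (- T); rewrite normrN; have := normr_ge0 T.
    by move=> *; rewrite ler_norml; apply/andP; split; lra.
  have bound z : (P `&` orthogonal_complement (lineality M)) z -> `|z| <= 1 + \sum_(k < d) N ^+ 2.
    move=> [Pz zU].
    have le : forall k, z k 0 ^+ 2 <= \sum_(k < d) N ^+ 2.
      move=> k; apply: (@le_trans _ _ (dotprod z z)).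
        rewrite /dotprod (bigD1 k)//= -expr2 lerDl.
        by apply: sumr_ge0 => j _; exact: sqr_ge0.
      apply: le_trans (orthogonal_le_pinvmx zU) _; apply: ler_sum => j _.
      set g := (pinvmx M *m _) j 0.
      have gN : `|g| <= N.
        rewrite /g mxE (le_trans (ler_norm_sum _ _ _))// /N (bigD1 j)//= ler_wpDr//.
          by apply: sumr_ge0 => l _; apply: sumr_ge0 => i _; rewrite mulr_ge0.
        by apply: ler_sum => i _; rewrite normrM ler_wpM2l//; exact: rowB.
      by rewrite -expr2 -[leLHS]real_normK ?num_real// lerXn2r// nnegrE (le_trans _ gN).
    have S0 : 0 <= \sum_(k < d) N ^+ 2 by apply: sumr_ge0 => k _; exact: sqr_ge0.
    apply: norm_le_coord => [|k]; first by rewrite addr_ge0.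
    apply: le_trans (_ : 1 + z k 0 ^+ 2 <= _); last by rewrite lerD2l.
    (* Uses |a| <= 1 + a^2, a consequence of (|a| - 1)^2 >= 0. *)
    by rewrite -[_ ^+ 2]real_normK ?num_real//; have := sqr_ge0 (`|z k 0| - 1); nra.
  rewrite /bounded_near /=; near=> C => z /bound zN; apply: (le_trans zN).
  near: C; exact: nbhs_pinfty_ge (num_real _).
move=> /pinfty_ex_gt0[C C0 bC].
exists (\sum_i (\sum_j `|M i j|) * C) => y Py _.
have [w /linealityP wU yw] := orthogonal_projection (lineality M) y.
have rE i : row_form M i (y - w) = row_form M i y by rewrite linearB /= wU subr0.
have yC : `|y - w| <= C.
  apply: bC; split; last exact: yw.
  by apply/polyhedronP => i; rewrite rE; exact: Py.
rewrite lerNl /row_sum -sumrN; apply: ler_sum => i _; rewrite -rE.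
apply: (le_trans (ler_norm _)); rewrite normrN (le_trans (row_form_le_norm _ _ _))//.
by rewrite ler_wpM2l// sumr_ge0.
Unshelve. all: by end_near. Qed.

End Value.

Lemma sign_ind_mem (n : nat) (Q : Prop) : (-1) ^+ n * ind Q \in [:: -1; 0; 1 : int].
Proof.
rewrite -signr_odd; have [q|q] := pselect Q; last by rewrite indF// mulr0 !inE.
by rewrite indT// mulr1; case: odd.
Qed.

Theorem theorem1p1 (R : realType) (d m : nat) (M : 'M[R]_(m, d)) (b : 'cV[R]_m)
    (P_neq0 : polyhedron M b !=set0) :
  (exists c : int, c \in [:: -1; 0; 1] /\
    forall x : 'cV[R]_d, varphi (polyhedron M b) x = c) /\
  (forall P0 : set 'cV[R]_d,
    polyhedral P0 -> line_free P0 ->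
    P0 `<=` orthogonal_complement (lineality M) ->
    polyhedron M b = minkowski_sum P0 [set` lineality M] ->
    (bounded_set P0 -> forall x : 'cV[R]_d,
      varphi (polyhedron M b) x = (-1) ^+ \dim (lineality M)) /\
    (~ bounded_set P0 -> forall x : 'cV[R]_d,
      varphi (polyhedron M b) x = 0)).
Proof.
have [J fJ Jmin] := min_feasible P_neq0.
split.
  eexists; split; last by move=> x; exact: varphi_value fJ Jmin.
  exact: sign_ind_mem.
move=> P0 _ _ P0U PE.
(* The decomposition determines [P0]: if [y = a + u] is orthogonal to the lineality space, then so
   is [u], which also lies in it, hence [u = 0]. *)
have -> : P0 = polyhedron M b `&` orthogonal_complement (lineality M).
  apply/seteqP; split=> [y P0y|y [Py yU]].
    by split; [rewrite PE; exists y => //; exists 0; rewrite ?addr0//=; exact: mem0v|exact: P0U].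
  move: (Py); rewrite PE => -[a P0a [u /= uU yE]].
  suff u0 : u = 0 by rewrite -yE u0 addr0.
  apply/eqP; apply: contraT => /dotprod_gt0.
  have := yU u uU; rewrite -yE dotprodC dotprodDr dotprodC (P0U _ P0a u uU) add0r => ->.
  by rewrite ltxx.
split=> [|] /(row_sum_boundedP fJ Jmin) bJ x; rewrite (varphi_value x fJ Jmin).
  by rewrite indT// mulr1.
by rewrite indF// mulr0.
Qed.
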